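(* Let $G=(V,E)$ be a non-bipartite, finite, simple, connected graph with $n=|V|$. Then $$\mu_x^{\mathcal Q}(\delta)\le\frac{d(x)\,\delta}{\mathscr K(G)},\qquad \delta\in[0,2),\ x\in V,$$ where $$\mathscr K(G):=\min\left\{\frac{\sum_{(v,u)\in E}|f(v)+f(u)|^2}{\max_{y\in V}|f(y)|^2}\ :\ f\colon V\to\mathbb R,\ \min_{y\in V}f(y)<0<\max_{y\in V}f(y)\right\},$$ and $\mathscr K(G)\ge\frac1{\mathrm{diam}(G)+1}$. Consequently, for $1\le k\le n$, $$\lambda_k^P\ge-1+\frac{k\,\mathscr K(G)}{\sum_{x\in V}d(x)}\ge-1+\frac{k}{(\mathrm{diam}(G)+1)\sum_{x\in V}d(x)}.$$ Furthermore, $\tau_\infty(1/4)\le 8n^3$; and if $G$ is also regular, then $\tau_\infty(1/4)\le 24n^2$.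
   Context: Graphs are undirected and unweighted; $d(x)$ is the degree of $x$; sums over $E$ count each edge once; $\mathrm{diam}(G)$ is the graph diameter. $\ell^2(V,d)$ is the Hilbert space of functions on $V$ with $\langle f,g\rangle_d=\sum_x d(x)f(x)\overline{g(x)}$. The transition operator of simple random walk is $(Pf)(x)=\frac1{d(x)}\sum_{y\sim x}f(y)$, self-adjoint on $\ell^2(V,d)$, with eigenvalues $\lambda_1^P\le\dots\le\lambda_n^P=1$ (with multiplicity); $\mathcal Q=I+P$. With $I_{\mathcal Q}([0,\delta])$ the spectral projection of $\mathcal Q$ for $[0,\delta]$ and $\mathbf e_x=\mathbf 1_x/\sqrt{d(x)}$, the vertex spectral measure is $\mu_x^{\mathcal Q}(\delta)=\langle I_{\mathcal Q}([0,\delta])\mathbf e_x,\mathbf e_x\rangle_d$. $p_t(x,y)$ is the $t$-step transition probability of simple random walk, $\pi(x)=d(x)/(2|E|)$, and the uniform mixing time is $\tau_\infty(\varepsilon)=\min\{t\ge0:\ \max_{x,y\in V}|p_t(x,y)-\pi(y)|/\pi(y)\le\varepsilon\}$. *)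

(* Defs.v *)
From mathcomp Require Export all_boot all_order all_algebra.
From mathcomp Require Export boolp classical_sets constructive_ereal reals ereal.
From mathcomp Require Export complex.

Set Implicit Arguments.
Unset Strict Implicit.
Unset Printing Implicit Defensive.

Import Order.TTheory GRing.Theory Num.Theory.
Local Open Scope ring_scope.
Local Open Scope complex_scope.

(* A finite simple graph is a symmetric irreflexive relation e : rel V on a
   finite type V of vertices. *)

Section Graph.
Variables (V : finType) (e : rel V).

Definition deg (x : V) : nat := #|[set y | e x y]|.

(* Unordered edges: by irreflexivity each is a two-element set. *)
Definition edges : {set {set V}} :=
  [set A | [exists x, exists y, e x y && (A == [set x; y])]].

Definition connected_graph : Prop := forall x y, connect e x y.

Definition bipartite : Prop :=
  exists A : {set V}, forall x y, e x y -> (x \in A) != (y \in A).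

Definition regular : Prop := exists r, forall x, deg x = r.

Definition walk (k : nat) (x y : V) : bool :=
  [exists p : k.-tuple V, path e x p && (last x p == y)].

(* The least length k < |V| of a walk from x to y; when x and y are connected
   a shortest walk has length < |V|, so this is the graph distance. *)
Definition dist (x y : V) : nat := find (fun k => walk k x y) (iota 0 #|V|).

Definition diam : nat := \max_(x : V) \max_(y : V) dist x y.

End Graph.

Section SignChanging.
Variables (R : realType) (V : finType) (e : rel V).

(* The edge {v, u} contributes |f v + f u| ^ 2. *)
Definition signless_energy (f : V -> R) : R :=
  \sum_(A in edges e) `|\sum_(x in A) f x| ^+ 2.

(* The neutral element 0 of the big operators does not affect these strict
   comparisons of the minimum and the maximum of f with 0. *)
Definition sign_changing (f : V -> R) : Prop :=
  \big[Num.min/0]_(y : V) f y < 0 < \big[Num.max/0]_(y : V) f y.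

Definition quotients : set R :=
  [set q | exists2 f : V -> R, sign_changing f &
     q = signless_energy f / \big[Num.max/0]_(y : V) (`|f y| ^+ 2)]%classic.

(* The minimum is written as the infimum of a set bounded below by 0; it is
   attained when [quotients e (Kconst R e)] holds. *)
Definition Kconst : R := inf quotients.

End SignChanging.

Section Spectral.
Variables (R : realType) (V : finType) (e : rel V).

Definition dotd (f g : V -> R[i]) : R[i] :=
  \sum_(x : V) (deg e x)%:R * f x * (g x)^*.

Definition transition_op (f : V -> R[i]) : V -> R[i] :=
  fun x => (deg e x)%:R^-1 * \sum_(y | e x y) f y.

Definition signless_op (f : V -> R[i]) : V -> R[i] :=
  fun x => f x + transition_op f x.

(* The sum of the eigenspaces of T for the eigenvalues in S. *)
Definition spectral_subspace (T : (V -> R[i]) -> V -> R[i]) (S : set R) :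
    set (V -> R[i]) :=
  [set f | exists (m : nat) (g : 'I_m -> V -> R[i]),
     (forall i, exists2 l : R, S l & forall x, T (g i) x = l%:C * g i x) /\
     (forall x, f x = \sum_(i < m) g i x)]%classic.

(* The orthogonal projection of f onto W in l^2(V, d). *)
Definition orth_proj (W : set (V -> R[i])) (f : V -> R[i]) : V -> R[i] :=
  xget (fun=> 0)
    [set g | W g /\ forall h, W h -> dotd (fun x => f x - g x) h = 0]%classic.

(* For T self-adjoint on the finite-dimensional space l^2(V, d), the spectral
   projection I_T(S) projects orthogonally onto the sum of the eigenspaces. *)
Definition spectral_proj (T : (V -> R[i]) -> V -> R[i]) (S : set R) :=
  orth_proj (spectral_subspace T S).

Definition unit_vec (x : V) : V -> R[i] :=
  fun y => (y == x)%:R / (Num.sqrt ((deg e x)%:R : R))%:C.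

Definition vertex_spectral_measure (x : V) (delta : R) : R[i] :=
  dotd (spectral_proj signless_op [set l | 0 <= l <= delta]%classic (unit_vec x))
       (unit_vec x).

Definition op_mx (T : (V -> R[i]) -> V -> R[i]) : 'M[R[i]]_#|V| :=
  \matrix_(i, j) T (fun x => (x == enum_val j)%:R) (enum_val i).

Definition char_roots (n : nat) (A : 'M[R[i]]_n) : seq R[i] :=
  sval (closed_field_poly_normal (char_poly A)).

(* The eigenvalues of P, with multiplicity, in nondecreasing order.  P is
   self-adjoint, so they are real and taking real parts loses nothing. *)
Definition transition_spectrum : seq R :=
  sort <=%R [seq complex.Re z | z <- char_roots (op_mx transition_op)].

(* The k-th smallest eigenvalue, for 1 <= k <= |V|. *)
Definition lambdaP (k : nat) : R := nth 0 transition_spectrum k.-1.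

End Spectral.

Section Walk.
Variables (R : realType) (V : finType) (e : rel V).

Fixpoint trans_prob (t : nat) (x y : V) : R :=
  if t is t'.+1 then \sum_(z | e x z) (deg e x)%:R^-1 * trans_prob t' z y
  else (x == y)%:R.

Definition stationary (x : V) : R := (deg e x)%:R / (2 * #|edges e|%:R).

Definition uniform_distance (t : nat) : R :=
  \big[Num.max/0]_(x : V) \big[Num.max/0]_(y : V)
    (`|trans_prob t x y - stationary y| / stationary y).

(* Infimum of a set of natural numbers in the extended reals: its least element,
   or +oo when the set is empty. *)
Definition uniform_mixing_time (eps : R) : \bar R :=
  ereal_inf [set t%:R%:E | t in [set t | uniform_distance t <= eps]]%classic.

End Walk.

(* Main.v *)
(* For f with positive and negative values, K = Kconst satisfies
   K |f x|^2 <= sum_E |f u + f v|^2 = <Q f, f>.  A spectral projection f of the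
   unit vector e_x for Q on [0, delta], delta < 2, is orthogonal to the constants,
   hence its real and imaginary parts are sign changing or zero; since moreover
   <Q f, f> <= delta |f|^2 and |f|^2 = mu_x(delta) = sqrt(d x) f(x), this gives
   the bound on mu_x(delta), and summing over x bounds the number of eigenvalues
   of P below a given level.  The bound K >= 1 / (diam + 1) comes from an
   alternating sum along a path: on an edge joining two vertices equidistant from
   x, one of the two parities of path length makes the end contributions add up.
   The same arguments for I - P control the positive part of the spectrum; both
   parts together give |p_t(x,y) / pi(y) - 1| <= 2|E| (2 diam + 1) / (t + 1). *)
Require Import Defs.
From mathcomp Require Import zify ring lra.
From mathcomp Require topology normedtype derive.
Set Implicit Arguments.
Unset Strict Implicit.
Unset Printing Implicit Defensive.
Import Order.TTheory GRing.Theory Num.Theory.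
Local Open Scope ring_scope.
Local Open Scope complex_scope.

(** * Distances and energies of paths *)

Section Distance.
Variables (V : finType) (e : rel V).

Lemma dist_le x p : path e x p -> (dist e x (last x p) <= size p)%N.
Proof.
move=> xp; rewrite leqNgt; apply/negP => lt_p.
have := before_find 0 lt_p; rewrite nth_iota; last first.
  by apply: leq_trans lt_p _; rewrite -[leqRHS](size_iota 0) find_size.
by rewrite add0n => /negbT/negP; apply; apply/existsP; exists (in_tuple p); rewrite xp /=.
Qed.

Lemma dist_path x y : connect e x y ->
  exists p, [/\ path e x p, last x p = y & size p = dist e x y].
Proof.
case/connectP => p xp ->; case: (shortenP xp) => q xq uq _.
have hw : has (fun k => walk e k x (last x q)) (iota 0 #|V|).
  apply/hasP; exists (size q).
    rewrite mem_iota /= add0n; rewrite -[(size q).+1]/(size (x :: q)).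
    by rewrite -(card_uniqP uq) max_card.
  by apply/existsP; exists (in_tuple q); rewrite xq /=.
have := nth_find 0 hw; rewrite nth_iota; last by rewrite -[ltnRHS](size_iota 0) -has_find.
rewrite add0n => /existsP[/= r /andP[xr /eqP lr]].
by exists r; split=> //; rewrite size_tuple.
Qed.

(** Deleting loops leaves a path inside [p] that still has at least the length of the distance, so
    nothing was deleted. *)
Lemma shortest_uniq x p : path e x p -> size p = dist e x (last x p) ->
  uniq (x :: p).
Proof.
move=> xp sp; case: (shortenP xp) (esym sp) => q xq uq sub_qp; move=> {}sp.
apply: leq_size_uniq uq _ _ => [z|] /=.
  by rewrite !inE; case: eqP => //= _; apply: sub_qp.
by rewrite ltnS -sp dist_le.
Qed.

(** The part of [p] up to [v] has length at least [dist e x v], so no step remains after [v]. *)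
Lemma shortest_last x p v : path e x p -> size p = dist e x (last x p) ->
  v \in x :: p -> (dist e x (last x p) <= dist e x v)%N -> v = last x p.
Proof.
move=> xp + vp; case/splitPl: p / vp xp => p1 p2 lv; rewrite cat_path last_cat lv.
case/andP=> xp1 _; rewrite size_cat => <- le_v.
have := dist_le xp1; rewrite lv => le1.
suff /size0nil -> : size p2 = 0%N by [].
by apply/eqP; rewrite -leqn0 -(leq_add2l (size p1)) addn0 (leq_trans le_v).
Qed.

Lemma dist_le_diam x y : (dist e x y <= diam e)%N.
Proof.
apply: (leq_trans (n := \max_z dist e x z)).
  exact: (leq_bigmax (F := fun z => dist e x z)).
exact: (leq_bigmax (F := fun x => \max_z dist e x z)).
Qed.

Hypothesis e_conn : connected_graph e.

Lemma dist_edge x u v : e u v -> (dist e x v <= (dist e x u).+1)%N.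
Proof.
move=> uv; have [p [xp lp sp]] := dist_path (e_conn x u).
have xpv : path e x (rcons p v) by rewrite rcons_path xp lp.
by have := dist_le xpv; rewrite last_rcons size_rcons sp.
Qed.

Lemma dist_lt_card x y : (dist e x y < #|V|)%N.
Proof.
have [p [xp lp sp]] := dist_path (e_conn x y).
rewrite -sp -[_.+1]/(size (x :: p)) -(card_uniqP _) ?max_card //.
by apply: shortest_uniq; rewrite ?lp.
Qed.

Lemma diam_lt_card : (0 < #|V|)%N -> (diam e < #|V|)%N.
Proof.
move=> n0; rewrite -(prednK n0) ltnS; apply/bigmax_leqP => x _.
by apply/bigmax_leqP => y _; rewrite -ltnS (prednK n0) dist_lt_card.
Qed.

(** Otherwise the parity of the distance to [x] would be a proper 2-colouring; on an edge with equal
    parities the distances, differing by at most one, coincide. *)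
Lemma nonbipartite_edge x : symmetric e -> ~ bipartite e ->
  exists u v, e u v /\ dist e x u = dist e x v.
Proof.
move=> e_sym nb.
have [/existsP[u /existsP[v /andP[uv /eqP d]]]|H] :=
  boolP [exists u, exists v, e u v && (odd (dist e x u) == odd (dist e x v))].
  exists u, v; split=> //.
  have h1 := dist_edge x uv; have h2 : (dist e x u <= (dist e x v).+1)%N.
    by apply: dist_edge; rewrite e_sym.
  by have := d; lia.
case: nb; exists [set v | odd (dist e x v)] => u v uv; rewrite !inE.
apply: contraNneq H => d; apply/existsP; exists u; apply/existsP; exists v.
by rewrite uv d /=.
Qed.

End Distance.

(** * Quadratic forms of I + P and I - P, bounded below along paths *)

Section Energy.
Variables (R : realFieldType) (V : finType) (e : rel V).

(* [s = 1] is the form of the signless Laplacian I + P, [s = -1] that of I - P. *)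
Definition energy (s : R) (f : V -> R) : R :=
  2^-1 * \sum_x \sum_(y | e x y) (f x + s * f y) ^+ 2.

Fixpoint path_energy (s : R) (f : V -> R) (x : V) (p : seq V) : R :=
  if p is y :: q then (f x + s * f y) ^+ 2 + path_energy s f y q else 0.

Implicit Types (s : R) (f : V -> R).

Lemma energy_ge0 s f : 0 <= energy s f.
Proof.
by rewrite mulr_ge0 // ?invr_ge0 ?ler0n //; do 2! (apply: sumr_ge0 => ? _); rewrite sqr_ge0.
Qed.

Lemma path_energy_ge0 s f x p : 0 <= path_energy s f x p.
Proof. by elim: p x => //= y p IH x; rewrite addr_ge0 ?sqr_ge0. Qed.

(** Cauchy-Schwarz for the sum of the terms [f x + s * f y] along the path with weights
    [(- s) ^+ i]: it telescopes to the left-hand difference, and the weights have square 1. The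
    induction proves both at once. *)
Lemma path_energy_telescope s f x p : s ^+ 2 = 1 ->
  (f x - (- s) ^+ size p * f (last x p)) ^+ 2
    <= (size p)%:R * path_energy s f x p.
Proof.
move=> s1; elim: p x => [|y p IH] x /=; first by rewrite expr0 mul1r subrr expr0n mul0r.
rewrite [(- s) ^+ _.+1]exprS; have {IH} := IH y; set c := _ * f (last y p); have := path_energy_ge0 s f y p.
set S := path_energy _ _ _ _; set b := f y - _ => S0 hb.
set a := f x + s * f y.
have -> : f x - - s * (- s) ^+ size p * f (last y p) = a - s * b.
  by rewrite /a /b /c; ring.
(* An empty tail is treated apart, because the general case multiplies the inequality by the length
   of the tail, which must be positive. *)
case: (size p) hb => [|L] hb.
  have b0 : b = 0 by apply/eqP; rewrite -sqrf_eq0 eq_le sqr_ge0 andbT; move: hb; rewrite mul0r.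
  by rewrite b0 mulr0 subr0 mul1r lerDl.
have L0 : 0 < (L.+1%:R : R) by rewrite ltr0n.
rewrite -[L.+2]addn1 natrD; move: (L.+1%:R : R) L0 hb => l l0 hb.
have sb : (s * b) ^+ 2 = b ^+ 2 by rewrite exprMn s1 mul1r.
rewrite -(ler_pM2l l0) -subr_ge0.
have -> : l * ((l + 1) * (a ^+ 2 + S)) - l * (a - s * b) ^+ 2 =
   (l * a + s * b) ^+ 2 + l * (l * S - (s * b) ^+ 2) + (l * S - (s * b) ^+ 2) by ring.
have hS : 0 <= l * S - b ^+ 2 by rewrite subr_ge0.
by rewrite sb; apply: addr_ge0 => //; apply: addr_ge0; rewrite ?sqr_ge0 // mulr_ge0 // ltW.
Qed.

Hypothesis e_sym : symmetric e.

(** A simple path uses each edge at most once, while [energy] takes half of the sum over both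
    orientations; [s ^+ 2 = 1] makes the terms independent of the orientation. *)
Lemma path_energy_le s f x p : s ^+ 2 = 1 -> path e x p -> uniq (x :: p) ->
  path_energy s f x p <= energy s f.
Proof.
move=> s1 xp up; rewrite /energy mulrC ler_pdivlMr ?ltr0n //.
pose F a b := (f a + s * f b) ^+ 2.
have F0 a b : 0 <= F a b by apply: sqr_ge0.
have FC a b : F a b = F b a.
  have -> : F a b = f a ^+ 2 + s *+ 2 * f a * f b + s ^+ 2 * f b ^+ 2 by rewrite /F; ring.
  have -> : F b a = f b ^+ 2 + s *+ 2 * f a * f b + s ^+ 2 * f a ^+ 2 by rewrite /F; ring.
  by rewrite s1; ring.
(* Intermediate sum over the oriented edges of the subgraph induced on the vertices of the path. In
   the induction, the head edge gives one term to the row of [x] and the reversed term to the row of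
   [y]. *)
apply: (@le_trans _ _ (\sum_(a <- x :: p) \sum_(b <- x :: p | e a b) F a b)).
  elim: p x xp {up} => [|y p IH] x /=.
    by move=> _; rewrite mul0r; do 2! (apply: sumr_ge0 => ? _); rewrite F0.
  case/andP=> xy yp; have {}IH := IH _ yp; rewrite -[_ ^+ 2]/(F x y).
  rewrite big_cons mulrDl.
  have -> : F x y * 2 = F x y + F y x by rewrite -(FC x y); ring.
  rewrite -addrA; apply: lerD.
    rewrite big_cons; case: ifP => _; rewrite big_cons xy ?(addrCA (F x x)) lerDl ?addr_ge0 //;
    by apply: sumr_ge0 => ? _.
  apply: (@le_trans _ _ (F y x + \sum_(a <- y :: p) \sum_(b <- y :: p | e a b) F a b)).
    by rewrite lerD2l.
  rewrite [leLHS](_ : _ = F y x + \sum_(b <- y :: p | e y b) F y b +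
     \sum_(a <- p) \sum_(b <- y :: p | e a b) F a b); last by rewrite big_cons addrA.
  rewrite [leRHS]big_cons; apply: lerD.
    by rewrite [leRHS]big_cons e_sym xy.
  apply: ler_sum => a _; rewrite [leRHS]big_cons; case: ifP => // _.
  by rewrite lerDr.
rewrite big_uniq //= [leRHS](bigID [in x :: p]) /= -[leLHS]addr0.
apply: lerD; last by do 2! (apply: sumr_ge0 => ? _); rewrite F0.
apply: ler_sum => a _; rewrite -big_filter big_uniq ?filter_uniq //.
rewrite [leRHS](bigID [in x :: p]) -[leLHS]addr0.
apply: lerD; last by apply: sumr_ge0 => b _; apply: F0.
rewrite [leLHS](eq_bigl (fun b => e a b && (b \in x :: p))) // => b.
by rewrite mem_filter.
Qed.

Hypothesis e_conn : connected_graph e.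

Lemma laplacian_diam f x y :
  (f x - f y) ^+ 2 <= (diam e)%:R * energy (-1) f.
Proof.
have [p [xp lp sp]] := dist_path (e_conn x y).
have s1 : (-1 : R) ^+ 2 = 1 by rewrite sqrrN expr1n.
have := path_energy_telescope f x p s1; rewrite opprK expr1n mul1r lp.
move/le_trans; apply; apply: ler_pM; rewrite ?ler0n ?path_energy_ge0 //.
  by rewrite ler_nat sp dist_le_diam.
by apply: path_energy_le => //; apply: (shortest_uniq (e := e)); rewrite ?lp.
Qed.

(* On two adjacent vertices at the same distance from [x], one reaches the
   second by paths of both parities; for one of them the telescoped end values
   have opposite signs. *)
Lemma signless_diam f x : irreflexive e -> ~ bipartite e ->
  f x ^+ 2 <= (diam e).+1%:R * energy 1 f.
Proof.
move=> e_irr nb; have [u [v [uv duv]]] := nonbipartite_edge e_conn x e_sym nb.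
suff [p [xp up sp neg]] : exists p, [/\ path e x p, uniq (x :: p),
    (size p <= (diam e).+1)%N & f x * ((-1) ^+ size p * f (last x p)) <= 0].
  have := path_energy_telescope f x p (expr1n _ 2); set c := _ * f (last x p) in neg *.
  move=> h; apply: (@le_trans _ _ ((f x - c) ^+ 2)).
    rewrite -subr_ge0 (_ : _ - _ = c ^+ 2 - 2 * (f x * c)); last by ring.
    by have := sqr_ge0 c; lra.
  apply: (le_trans h); apply: ler_pM; rewrite ?ler0n ?path_energy_ge0 ?ler_nat //.
  by apply: path_energy_le; rewrite ?expr1n.
have [pv [xpv lpv spv]] := dist_path (e_conn x v).
have [neg|pos] := leP (f x * ((-1) ^+ size pv * f v)) 0.
  exists pv; rewrite lpv; split=> //; first by apply: (shortest_uniq (e := e)); rewrite ?lpv.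
  by rewrite spv leqW // dist_le_diam.
have [pu [xpu lpu spu]] := dist_path (e_conn x u).
exists (rcons pu v); split.
- by rewrite rcons_path xpu lpu.
(* The vertex [v] is not on the geodesic to [u]: being as far from [x] as [u], it would be its
   endpoint [u], and [e] has no loops. *)
- rewrite -rcons_cons rcons_uniq (shortest_uniq xpu) ?lpu // andbT.
  apply/negP => vin; have := shortest_last xpu; rewrite lpu => /(_ _ spu vin).
  rewrite duv leqnn => /(_ isT) vu; by move: uv; rewrite vu e_irr.
- by rewrite size_rcons spu ltnS dist_le_diam.
- rewrite size_rcons last_rcons exprS spu duv -spv.
  by move: pos; set c := _ ^+ _; lra.
Qed.

End Energy.

(** * Minimizers of the energy on a compact box *)

Module BoxMinimum.
Import topology normedtype derive numFieldNormedType.Exports.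
Local Open Scope classical_set_scope.

(** Extreme value theorem, after functions on [V] are identified with row vectors through
    [enum_rank]. *)
Lemma energy_min_on_box (R : realType) (V : finType) (e : rel V) (s : R)
    (lo hi : V -> R) : (forall x, lo x <= hi x) ->
  exists2 f : V -> R, (forall x, lo x <= f x <= hi x) &
    forall g : V -> R, (forall x, lo x <= g x <= hi x) ->
      energy e s f <= energy e s g.
Proof.
move=> lohi.
pose F (v : 'rV[R]_#|V|) : V -> R := fun x => v ord0 (enum_rank x).
pose A := [set v : 'rV[R]_#|V| | forall i,
  [set` `[lo (enum_val i), hi (enum_val i)]%R] (v ord0 i)].
have boxF v : A v <-> forall x, lo x <= F v x <= hi x.
  split=> [Av x|Av i].
    by have := Av (enum_rank x); rewrite enum_rankK /= in_itv.
  by rewrite /= in_itv /=; have := Av (enum_val i); rewrite /F enum_valK.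
have A0 : A !=set0.
  exists (\row_i lo (enum_val i)); apply/boxF => x.
  by rewrite /F mxE enum_rankK lexx lohi.
have cA : compact A.
by apply: (@rV_compact R _ (fun i => [set` `[lo (enum_val i), hi (enum_val i)]%R])) => i; apply: segment_compact.
have addC : continuous (fun z : R * R => z.1 + z.2).
  by move=> z; apply: cvgD; [exact: cvg_fst | exact: cvg_snd].
have cE : continuous (fun v => energy e s (F v)).
  move=> v; apply: (@cvgM R _ (nbhs v)); first exact: cvg_cst.
  apply: (cvg_big addC) => x _; apply: (cvg_big addC) => y _.
  have cterm : {for v, continuous (fun v => F v x + s * F v y)}.
    apply: (@cvgD R R _ (nbhs v)); first exact: coord_continuous.
    by apply: (@cvgM R _ (nbhs v)); [exact: cvg_cst | exact: coord_continuous].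
  exact: (@cvgM R _ (nbhs v) _ _ _ _ _ cterm cterm).
have [v /set_mem Av vmin] := EVT_min_rV A0 cA (continuous_subspaceT cE).
exists (F v); first exact/boxF.
move=> g gbox; pose w : 'rV[R]_#|V| := \row_i g (enum_val i).
have Fw : F w =1 g by move=> x; rewrite /F mxE enum_rankK.
have Aw : A w by apply/boxF => x; rewrite Fw.
have := vmin w; rewrite inE => /(_ Aw) /le_trans; apply.
by rewrite /energy; under eq_bigr do under eq_bigr do rewrite !Fw.
Qed.

End BoxMinimum.

(** * The constant K(G) *)

Section Edges.
Variables (V : finType) (e : rel V).
Hypotheses (e_sym : symmetric e) (e_irr : irreflexive e).

Lemma edge_neq x y : e x y -> x != y.
Proof. by apply: contraTneq => ->; rewrite e_irr. Qed.

(** Each edge {x, y} comes from exactly two ordered pairs, distinct by irreflexivity. *)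
Lemma sum_edges (M : nmodType) (G : {set V} -> M) :
  \sum_x \sum_(y | e x y) G [set x; y] = (\sum_(A in edges e) G A) *+ 2.
Proof.
rewrite pair_big_dep /= (partition_big (fun p => [set p.1; p.2]) [in edges e]) /=.
  rewrite -sumrMnl; apply: eq_bigr => A.
  rewrite inE => /existsP[x /existsP[y /andP[xy /eqP ->]]].
  have nxy := edge_neq xy.
  rewrite (eq_bigr (fun=> G [set x; y])); last by move=> p /andP[_ /eqP ->].
  rewrite sumr_const; congr (_ *+ _).
  transitivity #|[set (x, y); (y, x)]|.
    apply: eq_card => -[a b]; rewrite unfold_in /= !inE -!pair_eqE /=.
    apply/idP/idP.
      case/andP=> ab /eqP E.
      have : a \in [set x; y] by rewrite -E set21.
      have : b \in [set x; y] by rewrite -E set22.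
      by rewrite !inE; do 2! (case/orP => /eqP ?); subst; rewrite ?eqxx ?orbT //;
        move: ab; rewrite e_irr.
    by case/orP => /andP[/eqP -> /eqP ->]; rewrite ?xy ?(e_sym y) ?xy ?eqxx //= finset.setUC eqxx.
  by rewrite cards2 xpair_eqE negb_and nxy.
case=> a b /= ab; rewrite inE; apply/existsP; exists a; apply/existsP; exists b.
by rewrite ab eqxx.
Qed.

Lemma sum_deg : (\sum_x deg e x = 2 * #|edges e|)%N.
Proof.
transitivity (\sum_x \sum_(y | e x y) 1)%N.
  by apply: eq_bigr => x _; rewrite sum1_card /deg cardsE.
have := sum_edges (fun=> 1%N) => /= ->.
by rewrite sum1_card mulr2n mul2n -addnn.
Qed.

Lemma deg_sum (R : pzSemiRingType) x : (deg e x)%:R = \sum_(y | e x y) 1 :> R.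
Proof.
rewrite sumr_const /deg; congr (_ *+ _).
by apply: eq_card => y; rewrite inE.
Qed.

Lemma signless_energyE (R : realType) (f : V -> R) :
  signless_energy e f = energy e 1 f.
Proof.
rewrite /energy /signless_energy.
have <- : \sum_x \sum_(y | e x y) `|\sum_(z in [set x; y]) f z| ^+ 2 =
   \sum_x \sum_(y | e x y) (f x + 1 * f y) ^+ 2.
  apply: eq_bigr => x _; apply: eq_bigr => y xy.
  by rewrite big_setU1 ?inE ?edge_neq //= big_set1 mul1r real_normK ?num_real.
by rewrite (sum_edges (fun A => `|\sum_(z in A) f z| ^+ 2)) -[X in _ * X]mulr_natl mulKf ?pnatr_eq0.
Qed.

Lemma edge_exists : ~ bipartite e -> exists x y, e x y.
Proof.
move=> nb; have [/existsP[x /existsP[y xy]]|H] := boolP [exists x, exists y, e x y].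
  by exists x, y.
case: nb; exists finset.set0 => x y xy; case/negP: H.
by apply/existsP; exists x; apply/existsP; exists y.
Qed.

(** Non-bipartiteness provides an edge, which excludes the one-vertex graph; a path from [x] to an
    endpoint of that edge then has a first step, unless [x] is that endpoint. *)
Lemma deg_gt0 x : connected_graph e -> ~ bipartite e -> (0 < deg e x)%N.
Proof.
move=> e_conn /edge_exists[a [b ab]].
have [->|xa] := eqVneq x a; first by apply/card_gt0P; exists b; rewrite inE.
have /connectP[[|c p] /= ] := e_conn x a; first by move=> _ ax; rewrite ax eqxx in xa.
by case/andP=> xc _ _; apply/card_gt0P; exists c; rewrite inE.
Qed.

End Edges.

(** * Attainment of K(G) and its bounds from both sides *)

Section Kconst.
Variables (R : realType) (V : finType) (e : rel V).
Hypotheses (e_sym : symmetric e) (e_irr : irreflexive e).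
Hypotheses (e_conn : connected_graph e) (e_nbip : ~ bipartite e).
Implicit Types f g : V -> R.

Lemma sign_changingP f :
  sign_changing f <-> (exists x, f x < 0) /\ (exists x, 0 < f x).
Proof.
split=> [/andP[fn fp]|[[x fx] [y fy]]].
  split; apply: contrapT => no.
    move: fn; rewrite ltNge => /negP; apply; apply: le_bigmin => // x _.
    by rewrite leNgt; apply/negP => fx; apply: no; exists x.
  move: fp; rewrite ltNge => /negP; apply; apply: bigmax_le => // x _.
  by rewrite leNgt; apply/negP => fx; apply: no; exists x.
apply/andP; split; first exact: le_lt_trans (bigmin_le 0 x f) fx.
exact: lt_le_trans fy (le_bigmax 0 f y).
Qed.

Lemma energyZ s c f : energy e s (fun x => c * f x) = c ^+ 2 * energy e s f.
Proof.
rewrite /energy mulrCA; congr (_ * _); rewrite mulr_sumr; apply: eq_bigr => x _.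
by rewrite mulr_sumr; apply: eq_bigr => y _; ring.
Qed.

Lemma maxsq_ge f x : f x ^+ 2 <= \big[Num.max/0]_y (`|f y| ^+ 2).
Proof.
apply: le_trans (le_bigmax _ (fun y => `|f y| ^+ 2) x).
by rewrite real_normK ?num_real.
Qed.

Lemma maxsq_attained f x : f x != 0 ->
  exists2 y, f y != 0 & \big[Num.max/0]_y (`|f y| ^+ 2) = f y ^+ 2.
Proof.
move=> fx; have [y Hy] : exists y, \big[Num.max/0]_y (`|f y| ^+ 2) = f y ^+ 2.
  have [|y _ ->] := @eq_bigmax _ _ _ 0 x predT (fun y => `|f y| ^+ 2) isT.
    by move=> y _; apply: sqr_ge0.
  by exists y; rewrite real_normK ?num_real.
exists y => //; rewrite -sqrf_eq0 -Hy gt_eqF //.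
by apply: lt_le_trans (maxsq_ge f x); rewrite exprn_even_gt0.
Qed.

Lemma Kconst_le f x : sign_changing f -> Kconst R e * f x ^+ 2 <= energy e 1 f.
Proof.
move=> scf; have [[z fz] _] := (sign_changingP f).1 scf.
have [y fy My] := maxsq_attained (ltr0_neq0 fz).
(* Since the constant is nonnegative, it suffices to treat a vertex [y] where the modulus of [f] is
   largest. *)
apply: (@le_trans _ _ (Kconst R e * f y ^+ 2)).
  apply: ler_wpM2l; last by rewrite -My maxsq_ge.
  apply: lb_le_inf; first by exists (signless_energy e f / \big[Num.max/0]_(y : V) (`|f y| ^+ 2)), f.
  move=> q [g scg ->]; rewrite signless_energyE //.
  rewrite divr_ge0 ?energy_ge0 //; exact: le_trans (sqr_ge0 (g x)) (maxsq_ge g x).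
rewrite -ler_pdivlMr ?exprn_even_gt0 // -My -signless_energyE //.
apply: ge_inf; last by exists f.
exists 0 => q [g scg ->]; rewrite signless_energyE //.
rewrite divr_ge0 ?energy_ge0 //; exact: le_trans (sqr_ge0 (g x)) (maxsq_ge g x).
Qed.

(** Only the edges at [a] change, each by [H]; their two orientations compensate the factor 1/2. No
    edge has both ends at [a], so no cross term in [c] arises. *)
Lemma energy_perturb f a c :
  energy e 1 (fun x => f x + c * (x == a)%:R) =
  energy e 1 f + 2 * c * \sum_(b | e a b) (f a + f b) + c ^+ 2 * (deg e a)%:R.
Proof.
pose H x y := 2 * c * (f x + f y) + c ^+ 2.
have -> : 2 * c * \sum_(b | e a b) (f a + f b) =
    \sum_(b | e a b) H a b - c ^+ 2 * (deg e a)%:R.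
  by rewrite deg_sum 2!mulr_sumr -sumrB; apply: eq_bigr => b _; rewrite /H; ring.
have delta (G : V -> R) : \sum_x (x == a)%:R * G x = G a.
  rewrite (bigD1 a) //= eqxx mul1r big1 ?addr0 // => x /negPf ->.
  by rewrite mul0r.
have E1 : \sum_x \sum_(y | e x y) (x == a)%:R * H x y = \sum_(b | e a b) H a b.
  by rewrite -[RHS](delta (fun x => \sum_(b | e x b) H x b)); apply: eq_bigr => x _; rewrite mulr_sumr.
have E2 : \sum_x \sum_(y | e x y) (y == a)%:R * H x y = \sum_(b | e a b) H a b.
  rewrite (exchange_big_dep predT) //= -E1; apply: eq_bigr => x _.
  by apply: eq_big => [y|y _]; rewrite ?[e y x]e_sym // /H addrC (addrC (f y)) addrC.
rewrite addrA subrK; set T := \sum_(b | e a b) H a b in E1 E2 *.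
have -> : T = 2^-1 * (T + T) by field.
rewrite /energy -mulrDr; congr (_ * _); rewrite -{1}E1 -E2 -!big_split /=.
apply: eq_bigr => x _; rewrite -!big_split /=; apply: eq_bigr => y xy.
have [xa|_] := eqVneq x a; have [ya|_] := eqVneq y a; rewrite /H /=; first last.
- by ring.
- by ring.
- by ring.
by have := edge_neq e_irr xy; rewrite xa ya eqxx.
Qed.

(** As a function of the value at [a] the energy is a parabola, minimal at [c = - (S / d)], where it
    has dropped by [S ^+ 2 / d]. Values of [f] at most 1 give [c >= -1]. *)
Lemma energy_lower f a b : (forall x, 0 <= f x <= 1) -> f a = 0 -> e a b -> 0 < f b ->
  exists2 c, -1 <= c < 0 &
    energy e 1 (fun x => f x + c * (x == a)%:R) < energy e 1 f.
Proof.
move=> f01 fa ab fb; pose d : R := (deg e a)%:R; pose S := \sum_(x | e a x) (f a + f x).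
have d0 : 0 < d by rewrite ltr0n (deg_gt0 _ e_conn e_nbip).
have S0 : 0 < S.
  rewrite /S (bigD1 b) //= fa add0r ltr_wpDr // sumr_ge0 // => x _.
  by rewrite add0r; case/andP: (f01 x).
have Sd : S <= d.
  by rewrite /d deg_sum ler_sum // => x _; rewrite fa add0r; case/andP: (f01 x).
exists (- (S / d)).
  by rewrite lerN2 oppr_lt0 divr_gt0 // ler_pdivrMr // mul1r Sd.
rewrite energy_perturb -/S -/d -addrA gtrDl.
have -> : 2 * - (S / d) * S + (- (S / d)) ^+ 2 * d = - (S ^+ 2 / d).
  by field; rewrite gt_eqF.
by rewrite oppr_lt0 divr_gt0 // exprn_gt0.
Qed.

Lemma energy_delta x : energy e 1 (fun y => (y == x)%:R : R) = (deg e x)%:R.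
Proof.
have := energy_perturb (fun=> 0) x 1.
rewrite [X in 2 * 1 * X]big1 ?mulr0 => [|y _]; last by rewrite addr0.
have -> : energy e 1 (fun=> 0 : R) = 0.
  by rewrite /energy big1 ?mulr0 // => y _; rewrite big1 // => z _; rewrite addr0 expr0n.
rewrite expr1n mul1r !add0r => <-; congr energy.
by apply/funext => y; rewrite add0r mul1r.
Qed.

(** The indicator of [x] has energy [deg e x]; lowering it at a neighbour makes it sign changing and
    only decreases the energy. This serves the eigenvalue bound at levels at least 1. *)
Lemma Kconst_le_deg x : Kconst R e <= (deg e x)%:R.
Proof.
have /card_gt0P[a] := deg_gt0 x e_conn e_nbip; rewrite inE => xa.
have nxa := edge_neq e_irr xa.
have [||||c /andP[c1 c0] lt] := @energy_lower (fun y => (y == x)%:R) a x.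
- by move=> y; case: eqP; rewrite ?ler01 ?lexx.
- by rewrite eq_sym (negPf nxa).
- by rewrite e_sym.
- by rewrite eqxx ltr01.
rewrite -energy_delta; apply: le_trans (ltW lt).
pose g y : R := (y == x)%:R + c * (y == a)%:R.
have gx : g x = 1 by rewrite /g eqxx (negPf nxa) mulr0 addr0.
have := @Kconst_le g x; rewrite gx expr1n mulr1; apply; apply/sign_changingP; split.
  by exists a; rewrite /g eq_sym (negPf nxa) eqxx add0r mulr1.
by exists x; rewrite gx.
Qed.

Lemma zero_boundary f x y : f x = 0 -> f y != 0 ->
  exists a b, [/\ e a b, f a = 0 & f b != 0].
Proof.
move=> fx; have /connectP[p xp ->] := e_conn x y.
elim: p x fx xp => [|z p IH] x fx /=; first by rewrite fx eqxx.
case/andP=> xz zp; have [fz|fz _] := eqVneq (f z) 0; first exact: IH zp.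
by exists x, z.
Qed.

(* Sign changing functions do not form a closed set; but a minimizer under
   [f y = 1], [|f| <= 1], [f z <= 0] takes a negative value, since otherwise
   lowering it at a zero adjacent to a positive value would decrease the energy. *)
Lemma Kconst_attained : quotients e (Kconst R e).
Proof.
(* Box of the functions with [f y = 1], [f z <= 0] and modulus at most 1. The test for [y] comes
   first, so the box is nonempty even for [y = z]; such pairs are discarded when the best pair is
   chosen. *)
pose lo (y x : V) : R := if x == y then 1 else -1.
pose hi (y z x : V) : R := if x == y then 1 else if x == z then 0 else 1.
have lohi y z x : lo y x <= hi y z x.
  by rewrite /lo /hi; case: (x == y); [lra | case: (x == z); lra].
have /boolp.choice[F HF] : forall p : V * V, exists f : V -> R,
    (forall x, lo p.1 x <= f x <= hi p.1 p.2 x) /\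
    (forall g : V -> R, (forall x, lo p.1 x <= g x <= hi p.1 p.2 x) ->
       energy e 1 f <= energy e 1 g).
  move=> p; have [f fb fm] := BoxMinimum.energy_min_on_box e 1 (lohi p.1 p.2).
  by exists f.
have [u [v uv]] := edge_exists e_nbip.
case: (@arg_minP _ _ _ (u, v) (fun p => p.1 != p.2) (fun p => energy e 1 (F p))).
  exact: edge_neq uv.
move=> [y z] /= nyz pmin; set f := F (y, z) in pmin *.
have [/= fbox _] := HF (y, z); rewrite -/f in fbox.
have fmin g a b : g a = 1 -> (forall x, -1 <= g x <= 1) -> g b <= 0 ->
    energy e 1 f <= energy e 1 g.
  move=> ga g1 gb; have nab : a != b by apply: contraTneq gb => <-; rewrite ga -ltNge ltr01.
  apply: le_trans (pmin (a, b) nab) _; apply: (HF (a, b)).2 => x /=.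
  rewrite /lo /hi; case: eqP => [->|_]; first by rewrite ga lexx.
  by case: eqP => [->|_]; rewrite ?gb ?andbT; case/andP: (g1 x); case/andP: (g1 b).
have fy : f y = 1 by apply/eqP; have := fbox y; rewrite /lo /hi eqxx eq_le andbC.
have f1 x : -1 <= f x <= 1.
  by have := fbox x; rewrite /lo /hi; case: (x == y); [lra | case: (x == z); lra].
have fz : f z <= 0.
  by have := fbox z; rewrite /lo /hi eq_sym (negPf nyz) eqxx => /andP[].
have scf : sign_changing f.
  apply/sign_changingP; split; last by exists y; rewrite fy.
  apply: contrapT => fneg; have f0 x : 0 <= f x.
    by rewrite leNgt; apply/negP => fx; apply: fneg; exists x.
  have [||a [b [ab fa fb]]] := @zero_boundary f z y.
  - by apply/eqP; rewrite eq_le fz f0.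
  - by rewrite fy oner_neq0.
  have [||c /andP[c1 c0]] := energy_lower _ fa ab.
  - by move=> x; rewrite f0; case/andP: (f1 x).
  - by rewrite lt_def fb f0.
  (* The lowered function competes in the box of [(y, a)]: the vertex [a], where it is now negative,
     replaces [z]. *)
  rewrite ltNge => /negP; apply; apply: (fmin _ y a).
  - rewrite (_ : y == a = false) ?mulr0 ?addr0 //.
    by apply/negP => /eqP ya; move: fy; rewrite ya fa => /esym/eqP; rewrite oner_eq0.
  - move=> x; case: eqP => [->|_]; last by rewrite mulr0 addr0.
    by rewrite fa add0r mulr1 c1 ltW // (lt_trans c0).
  - by rewrite fa add0r eqxx mulr1 ltW.
have fmax : \big[Num.max/0]_x (`|f x| ^+ 2) = 1.
  apply/eqP; rewrite eq_le; apply/andP; split; last by have := maxsq_ge f y; rewrite fy expr1n.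
  apply: bigmax_le => [|x _]; first exact: ler01.
  by rewrite expr_le1 // ler_norml f1.
exists f => //; apply/eqP; rewrite eq_le; apply/andP; split.
  rewrite signless_energyE // fmax divr1.
  by have := Kconst_le y scf; rewrite fy expr1n mulr1.
apply: lb_le_inf; first by exists (signless_energy e f / \big[Num.max/0]_x (`|f x| ^+ 2)), f.
move=> q [g scg ->]; rewrite !signless_energyE // fmax divr1.
have [[a ga] [b gb]] := (sign_changingP g).1 scg.
have [w gw gM] := maxsq_attained (ltr0_neq0 ga).
(* A competitor is divided by its value of largest modulus. The sign of that value decides which of
   [a] and [b] supplies the nonpositive value required by the box. *)
rewrite gM mulrC -exprVn -energyZ.
have [u' gu'] : exists u', (g w)^-1 * g u' <= 0.
  have [w0|w0|w0] := ltgtP (g w) 0; last by rewrite w0 eqxx in gw.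
    by exists b; rewrite mulr_le0_ge0 ?invr_le0 // ltW.
  by exists a; rewrite mulr_ge0_le0 ?invr_ge0 // ltW.
apply: (fmin _ w u') => //; first by rewrite mulVf.
move=> x; rewrite -ler_norml -(expr_le1 (n := 2)) // real_normK ?num_real //.
by rewrite exprMn exprVn mulrC ler_pdivrMr ?exprn_even_gt0 // mul1r -gM maxsq_ge.
Qed.

Lemma Kconst_ge : 1 / ((diam e)%:R + 1) <= Kconst R e.
Proof.
have [f scf ->] := Kconst_attained; have [[x fx] _] := (sign_changingP f).1 scf.
have [y fy ->] := maxsq_attained (ltr0_neq0 fx).
rewrite signless_energyE // natr1 ler_pdivrMr ?ltr0n //.
by rewrite mulrAC ler_pdivlMr ?exprn_even_gt0 // mul1r mulrC signless_diam.
Qed.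

Lemma Kconst_gt0 : 0 < Kconst R e.
Proof. by apply: lt_le_trans Kconst_ge; rewrite divr_gt0 // natr1 ltr0n. Qed.

(** A nonnegative function of weighted mean zero vanishes, all degrees being positive; this is
    applied to [f] and to [- f]. *)
Lemma orthogonal_sign_changing f x : \sum_y (deg e y)%:R * f y = 0 -> f x != 0 ->
  sign_changing f.
Proof.
move=> f0 fx; have degp y : 0 < (deg e y)%:R :> R by rewrite ltr0n (deg_gt0 _ e_conn e_nbip).
have key (g : V -> R) : \sum_y (deg e y)%:R * g y = 0 -> g x != 0 -> exists y, g y < 0.
  move=> g0 gx; apply: contrapT => no.
  have gp y : 0 <= g y by rewrite leNgt; apply/negP => gy; apply: no; exists y.
  move/eqP: g0; rewrite psumr_eq0 => [/allP/(_ x)|y _]; last by rewrite mulr_ge0 // ltW.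
  by rewrite mem_index_enum mulf_eq0 (negPf gx) gt_eqF // => /(_ isT).
apply/sign_changingP; split; first exact: key.
have [||y] := key (fun y => - f y); last by rewrite oppr_lt0; exists y.
  by under eq_bigr do rewrite mulrN; rewrite sumrN f0 oppr0.
by rewrite oppr_eq0.
Qed.

Lemma Kconst_orthogonal f x : \sum_y (deg e y)%:R * f y = 0 ->
  Kconst R e * f x ^+ 2 <= energy e 1 f.
Proof.
move=> f0; have [->|fx] := eqVneq (f x) 0; first by rewrite expr0n mulr0 energy_ge0.
exact/Kconst_le/(orthogonal_sign_changing f0 fx).
Qed.

(** Some vertex carries a value of sign opposite to that of [f x], so the difference of the two
    values is at least [f x] in modulus. *)
Lemma laplacian_orthogonal f x : \sum_y (deg e y)%:R * f y = 0 ->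
  f x ^+ 2 <= (diam e)%:R * energy e (-1) f.
Proof.
move=> f0; have [->|fx] := eqVneq (f x) 0.
  by rewrite expr0n mulr_ge0 ?ler0n ?energy_ge0.
have [[y fy] [z fz]] := (sign_changingP f).1 (orthogonal_sign_changing f0 fx).
have [fxp|fxn] := leP 0 (f x).
  by apply: le_trans (laplacian_diam e_sym e_conn f x y); nra.
by apply: le_trans (laplacian_diam e_sym e_conn f x z); nra.
Qed.

End Kconst.

(** * Complex functions and the spectral measure *)

Section SquareModulus.
Variable R : rcfType.
Implicit Types z w : R[i].

Definition sqmod z : R := complex.Re z ^+ 2 + complex.Im z ^+ 2.

Lemma sqmodE z : (sqmod z)%:C = z * z^*.
Proof.
by case: z => a b; rewrite /sqmod; simpc; congr (_ +i* _); rewrite /=; ring.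
Qed.

Lemma sqmod_ge0 z : 0 <= sqmod z.
Proof. by rewrite addr_ge0 ?sqr_ge0. Qed.

Lemma sqmodM z w : sqmod (z * w) = sqmod z * sqmod w.
Proof. by apply: complexI; rewrite rmorphM /= !sqmodE rmorphM /= mulrACA. Qed.

Lemma sqmodR (a : R) : sqmod a%:C = a ^+ 2.
Proof. by rewrite /sqmod /= expr0n addr0. Qed.

Lemma sqmod_conj z : sqmod z^*%R = sqmod z.
Proof. by case: z => a b; rewrite /sqmod /= sqrrN. Qed.

Lemma conjD z w : (z + w)^*%R = z^* + w^*.
Proof. exact: rmorphD. Qed.

Lemma conjM z w : (z * w)^*%R = z^* * w^*.
Proof. exact: rmorphM. Qed.

Lemma conjV z : (z^-1)^*%R = (z^*)^-1.
Proof. exact: fmorphV. Qed.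

Lemma conj_sum (I : Type) (r : seq I) (P : pred I) (F : I -> R[i]) :
  (\sum_(i <- r | P i) F i)^*%R = \sum_(i <- r | P i) (F i)^*%R.
Proof. exact: rmorph_sum. Qed.

Lemma conj_real (a : R) : (a%:C)^*%R = a%:C.
Proof. exact: conjc_real. Qed.

End SquareModulus.

Section ComplexEnergy.
Variables (R : realType) (V : finType) (e : rel V).
Implicit Types f g : V -> R[i].

(** Hermitian extension of the real form, kept real valued so that the estimates for real functions
    apply to the real and imaginary parts separately. *)
Definition cenergy (s : R) f : R :=
  energy e s (fun x => complex.Re (f x)) + energy e s (fun x => complex.Im (f x)).

Lemma cenergy_sqmod s f :
  cenergy s f = 2^-1 * \sum_x \sum_(y | e x y) sqmod (f x + s%:C * f y).
Proof.
rewrite /cenergy /energy -mulrDr -big_split /=; congr (_ * _).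
apply: eq_bigr => x _; rewrite -big_split /=; apply: eq_bigr => y _.
by case: (f x) (f y) => [a b] [c d]; rewrite /sqmod /=; ring.
Qed.

Lemma cenergy_ge0 s f : 0 <= cenergy s f.
Proof. by rewrite addr_ge0 ?energy_ge0. Qed.

Hypotheses (e_sym : symmetric e) (e_irr : irreflexive e).

Lemma dotd_norm f : dotd e f f = (\sum_x (deg e x)%:R * sqmod (f x))%:C.
Proof.
rewrite /dotd rmorph_sum; apply: eq_bigr => x _ /=.
by rewrite rmorphM /= rmorph_nat sqmodE mulrA.
Qed.

(** Expanding the squares, each of the two diagonal sums is the squared norm and the two cross sums
    agree by symmetry of [e]; the result is the form of I + sP. *)
Lemma cenergyE (s : R) f : s ^+ 2 = 1 ->
  (cenergy s f)%:C =
  dotd e f f + s%:C * \sum_x \sum_(y | e x y) f y * (f x)^*.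
Proof.
move=> s1; have sC : s%:C * s%:C = 1 by rewrite -rmorphM -expr2 s1.
have D1 : \sum_x \sum_(y | e x y) f x * (f x)^* = dotd e f f.
  by apply: eq_bigr => x _; rewrite -mulr_suml deg_sum !mulr_suml; apply: eq_bigr => y _; ring.
have D2 : \sum_x \sum_(y | e x y) f y * (f y)^* = dotd e f f.
  rewrite (exchange_big_dep predT) //= -D1; apply: eq_bigr => x _.
  by apply: eq_bigl => y; rewrite e_sym.
have T2 : \sum_x \sum_(y | e x y) f x * (f y)^* = \sum_x \sum_(y | e x y) f y * (f x)^*.
  rewrite (exchange_big_dep predT) //=; apply: eq_bigr => x _.
  by apply: eq_bigl => y; rewrite e_sym.
transitivity (2^-1 * \sum_x \sum_(y | e x y) (f x * (f x)^* + s%:C * (f x * (f y)^*) +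
    (s%:C * (f y * (f x)^*) + f y * (f y)^*))).
  rewrite cenergy_sqmod rmorphM /= fmorphV /= rmorph_nat rmorph_sum; congr (_ * _).
  apply: eq_bigr => x _ /=; rewrite rmorph_sum; apply: eq_bigr => y _ /=.
  rewrite sqmodE conjD conjM conj_real.
  transitivity (f x * (f x)^* + s%:C * (f x * (f y)^*) +
    (s%:C * (f y * (f x)^*) + s%:C * s%:C * (f y * (f y)^*))); first by ring.
  by rewrite sC mul1r.
have -> : \sum_x \sum_(y | e x y) (f x * (f x)^* + s%:C * (f x * (f y)^*) +
    (s%:C * (f y * (f x)^*) + f y * (f y)^*)) =
  \sum_x \sum_(y | e x y) f x * (f x)^* +
  s%:C * (\sum_x \sum_(y | e x y) f x * (f y)^*) +
  (s%:C * (\sum_x \sum_(y | e x y) f y * (f x)^*) +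
   \sum_x \sum_(y | e x y) f y * (f y)^*).
  rewrite !mulr_sumr -!big_split; apply: eq_bigr => x _ /=.
  by rewrite !mulr_sumr -!big_split; apply: eq_bigr => y _ /=.
by rewrite D1 D2 T2; field.
Qed.

End ComplexEnergy.

Section WeightedInnerProduct.
Variables (R : realType) (V : finType) (e : rel V).
Hypotheses (e_sym : symmetric e) (e_irr : irreflexive e).
Hypotheses (e_conn : connected_graph e) (e_nbip : ~ bipartite e).
Implicit Types f g : V -> R[i].

Lemma dotd_suml (I : Type) (r : seq I) (P : pred I) (F : I -> V -> R[i]) g :
  dotd e (fun x => \sum_(i <- r | P i) F i x) g = \sum_(i <- r | P i) dotd e (F i) g.
Proof.
rewrite /dotd exchange_big /=; apply: eq_bigr => x _.
by rewrite mulr_sumr mulr_suml.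
Qed.

Lemma dotdZl c f g : dotd e (fun x => c * f x) g = c * dotd e f g.
Proof. by rewrite /dotd mulr_sumr; apply: eq_bigr => x _; ring. Qed.

Lemma dotd_conj f g : dotd e g f = (dotd e f g)^*%R.
Proof.
rewrite /dotd conj_sum; apply: eq_bigr => x _.
by rewrite !conjM conjCK conjC_nat; ring.
Qed.

Lemma dotd_sumr (I : Type) (r : seq I) (P : pred I) (F : I -> V -> R[i]) f :
  dotd e f (fun x => \sum_(i <- r | P i) F i x) = \sum_(i <- r | P i) dotd e f (F i).
Proof.
rewrite dotd_conj dotd_suml conj_sum; apply: eq_bigr => i _.
by rewrite -dotd_conj.
Qed.

Lemma dotdZr c f g : dotd e f (fun x => c * g x) = c^* * dotd e f g.
Proof. by rewrite dotd_conj dotdZl conjM -dotd_conj. Qed.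

Lemma dotdBl f f' g :
  dotd e (fun x => f x - f' x) g = dotd e f g - dotd e f' g.
Proof. by rewrite /dotd -sumrB; apply: eq_bigr => x _; ring. Qed.

Lemma deg_neq0 x : (deg e x)%:R != 0 :> R[i].
Proof. by rewrite pnatr_eq0 -lt0n (deg_gt0 x e_conn e_nbip). Qed.

Lemma dotd_transition f g :
  dotd e (transition_op e f) g = \sum_x \sum_(y | e x y) f y * (g x)^*.
Proof.
apply: eq_bigr => x _; rewrite /transition_op mulrA mulfV ?deg_neq0 // mul1r.
by rewrite mulr_suml.
Qed.

Lemma transition_selfadjoint f g :
  dotd e (transition_op e f) g = dotd e f (transition_op e g).
Proof.
rewrite [RHS]dotd_conj !dotd_transition conj_sum.
rewrite (exchange_big_dep predT) //=; apply: eq_bigr => x _.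
rewrite conj_sum; apply: eq_big => [y|y _]; first by rewrite e_sym.
by rewrite conjM conjCK mulrC.
Qed.

Definition transition_eigen (l : R) f := forall x, transition_op e f x = l%:C * f x.

Lemma transition_eigen1 : transition_eigen 1 (fun=> 1).
Proof.
by move=> x; rewrite /transition_op -deg_sum mulVf ?deg_neq0 // mulr1.
Qed.

Lemma eigen_orthogonal l m f g : transition_eigen l f -> transition_eigen m g ->
  l != m -> dotd e f g = 0.
Proof.
move=> Pf Pg lm; have := transition_selfadjoint f g.
rewrite (_ : transition_op e f = fun x => l%:C * f x); last exact/funext.
rewrite (_ : transition_op e g = fun x => m%:C * g x); last exact/funext.
rewrite dotdZl dotdZr conj_real => /eqP; rewrite -subr_eq0 -mulrBl mulf_eq0.
case/orP => [|/eqP //]; rewrite subr_eq0 => /eqP/complexI lm'.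
by rewrite lm' eqxx in lm.
Qed.

Lemma cenergy_dotd (s : R) f : s ^+ 2 = 1 ->
  (cenergy e s f)%:C = dotd e f f + s%:C * dotd e (transition_op e f) f.
Proof. by move=> s1; rewrite cenergyE // dotd_transition. Qed.

Lemma orthogonal_ReIm f : dotd e f (fun=> 1) = 0 ->
  \sum_x (deg e x)%:R * complex.Re (f x) = 0 /\
  \sum_x (deg e x)%:R * complex.Im (f x) = 0.
Proof.
have -> : dotd e f (fun=> 1) =
    Complex (\sum_x (deg e x)%:R * complex.Re (f x)) (\sum_x (deg e x)%:R * complex.Im (f x)).
  rewrite [RHS]complexE /= !rmorph_sum mulr_sumr -big_split; apply: eq_bigr => x _ /=.
  by rewrite conjC1 mulr1 [in LHS](complexE (f x)) !rmorphM /= !rmorph_nat; ring.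
by case.
Qed.

Lemma Kconst_cenergy f x : dotd e f (fun=> 1) = 0 ->
  Kconst R e * sqmod (f x) <= cenergy e 1 f.
Proof.
by case/orthogonal_ReIm=> fR fI; rewrite mulrDr lerD // Kconst_orthogonal.
Qed.

Lemma laplacian_cenergy f x : dotd e f (fun=> 1) = 0 ->
  sqmod (f x) <= (diam e)%:R * cenergy e (-1) f.
Proof.
by case/orthogonal_ReIm=> fR fI; rewrite mulrDr lerD // laplacian_orthogonal.
Qed.

Lemma signless_cenergy f x : sqmod (f x) <= (diam e).+1%:R * cenergy e 1 f.
Proof. by rewrite mulrDr lerD // signless_diam. Qed.

Lemma laplacian_kernel f x y : cenergy e (-1) f = 0 -> f x = f y.
Proof.
move=> f0; have hR := energy_ge0 e (-1) (fun x => complex.Re (f x)).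
have hI := energy_ge0 e (-1) (fun x => complex.Im (f x)).
have [zR zI] : energy e (-1) (fun x => complex.Re (f x)) = 0 /\
    energy e (-1) (fun x => complex.Im (f x)) = 0.
  by move: f0; rewrite /cenergy; lra.
have := laplacian_diam e_sym e_conn (fun x => complex.Re (f x)) x y.
have := laplacian_diam e_sym e_conn (fun x => complex.Im (f x)) x y.
rewrite zR zI !mulr0 !real_exprn_even_le0 ?num_real //= !subr_eq0 => /eqP fI /eqP fR.
by rewrite (complexE (f x)) fR fI -complexE.
Qed.

(* Eigenvectors for distinct eigenvalues are orthogonal, hence
   sum_ij (delta - l_i) <g_i, g_j> = |sum_i (delta - l_i)^(1/2) g_i|^2 >= 0. *)
Lemma spectral_subspace_energy (delta : R) f : delta < 2 ->
  spectral_subspace (signless_op e) [set l | 0 <= l <= delta]%classic f ->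
  dotd e f (fun=> 1) = 0 /\
  cenergy e 1 f <= delta * \sum_x (deg e x)%:R * sqmod (f x).
Proof.
move=> d2 [m [g [/= Hg /funext ->]]].
have /boolp.choice[l Hl] : forall i, exists l : R, 0 <= l <= delta /\
    transition_eigen (l - 1) (g i).
  move=> i; have [l l01 gl] := Hg i; exists l; split=> // x.
  have := gl x; rewrite /signless_op rmorphB /= mulrBl mul1r => <-.
  by rewrite addrC addKr.
split.
  (* As [delta < 2], the eigenvalue [l i - 1] of P is below 1, the eigenvalue of the constants. *)
  rewrite dotd_suml big1 // => i _; have [/andP[_ ld] gl] := Hl i.
  by apply: eigen_orthogonal gl transition_eigen1 _; rewrite lt_eqF //; lra.
set F := fun x => \sum_i g i x.
have orth i j : l i != l j -> dotd e (g i) (g j) = 0.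
  move=> lij; apply: eigen_orthogonal (Hl i).2 (Hl j).2 _.
  by apply: contra lij => /eqP h; apply/eqP; lra.
pose s i : R[i] := (Num.sqrt (delta - l i))%:C.
have sE i j : (delta - l i)%:C * dotd e (g i) (g j) = s i * s j * dotd e (g i) (g j).
  have [lij|lij] := eqVneq (l i) (l j); last by rewrite orth // !mulr0.
  have dl : 0 <= delta - l j by have [/andP[_ h] _] := Hl j; rewrite subr_ge0.
  by rewrite /s lij -rmorphM -expr2 sqr_sqrtr.
rewrite -subr_ge0 -ler0c rmorphB rmorphM /= -dotd_norm cenergy_dotd ?expr1n //.
have -> : transition_op e F = fun x => \sum_i (l i - 1)%:C * g i x.
  apply/funext => x; rewrite /transition_op /F exchange_big mulr_sumr.
  by apply: eq_bigr => i _; rewrite -(Hl i).2.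
rewrite mul1r; suff -> : delta%:C * dotd e F F - (dotd e F F +
    dotd e (fun x => \sum_i (l i - 1)%:C * g i x) F) =
    dotd e (fun x => \sum_i s i * g i x) (fun x => \sum_i s i * g i x).
  by rewrite dotd_norm ler0c sumr_ge0 // => x _; rewrite mulr_ge0 ?ler0n ?sqmod_ge0.
transitivity (\sum_i (delta - l i)%:C * dotd e (g i) F).
  rewrite {1 2}/F !dotd_suml mulr_sumr -big_split -sumrB /=; apply: eq_bigr => i _.
  by rewrite dotdZl !rmorphB rmorph1; ring.
rewrite dotd_suml; apply: eq_bigr => i _; rewrite dotdZl dotd_sumr /F dotd_sumr !mulr_sumr.
by apply: eq_bigr => j _; rewrite sE dotdZr conj_real mulrA.
Qed.

End WeightedInnerProduct.

(** * The bound on the vertex spectral measure *)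

Section VertexMeasure.
Variables (R : realType) (V : finType) (e : rel V).
Hypotheses (e_sym : symmetric e) (e_irr : irreflexive e).
Hypotheses (e_conn : connected_graph e) (e_nbip : ~ bipartite e).
Implicit Types f g : V -> R[i].

Lemma deg_pos x : 0 < (deg e x)%:R :> R.
Proof. by rewrite ltr0n deg_gt0. Qed.

Lemma dotd_unit_vec f x :
  dotd e f (unit_vec R e x) = (Num.sqrt (deg e x)%:R)%:C * f x.
Proof.
rewrite /dotd (bigD1 x) //= big1 => [|y /negPf yx]; last first.
  by rewrite /unit_vec yx mul0r conjC0 mulr0.
rewrite /unit_vec eqxx addr0 mul1r conjV conj_real.
have d0 := deg_pos x; have s0 : (Num.sqrt (deg e x)%:R : R) != 0.
  by rewrite sqrtr_eq0 -ltNge.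
have -> : (deg e x)%:R = (Num.sqrt (deg e x)%:R : R)%:C * (Num.sqrt (deg e x)%:R : R)%:C.
  by rewrite -rmorphM -expr2 sqr_sqrtr ?(ltW d0) //= rmorph_nat.
have : (Num.sqrt (deg e x)%:R : R)%:C != 0 by apply: contra s0 => /eqP[->].
by move: (_%:C) => s s1; field.
Qed.

(** Here a^2 = d(x) |f(x)|^2, while K |f(x)|^2 is at most the energy, hence at most delta a;
    dividing by [a] gives the claim. Being free of [orth_proj], the statement also serves for sums
    over an eigenbasis. *)
Lemma spectral_subspace_bound (delta a : R) f x : delta < 2 -> 0 <= a ->
  spectral_subspace (signless_op e) [set l | 0 <= l <= delta]%classic f ->
  dotd e f f = a%:C -> dotd e f (unit_vec R e x) = a%:C -> 0 <= delta ->
  a <= (deg e x)%:R * delta / Kconst R e.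
Proof.
move=> d2 a0 Wf ffa fxa d0.
have K0 := Kconst_gt0 R e_sym e_irr e_conn e_nbip.
have [f1 fE] := spectral_subspace_energy e_sym e_conn e_nbip d2 Wf.
have := Kconst_cenergy e_sym e_irr e_conn e_nbip x f1.
move: ffa; rewrite dotd_norm => /complexI ffa; rewrite ffa in fE.
have : sqmod (dotd e f (unit_vec R e x)) = a ^+ 2 by rewrite fxa sqmodR.
rewrite dotd_unit_vec sqmodM sqmodR sqr_sqrtr ?ler0n // => aE Kle.
have dx := deg_pos x.
rewrite ler_pdivlMr //; have [->|an] := eqVneq a 0; first by rewrite mul0r mulr_ge0 ?ler0n.
have ap : 0 < a by rewrite lt_def an.
rewrite -(ler_pM2l ap) mulrA -expr2 -aE -mulrA.
have -> : a * ((deg e x)%:R * delta) = (deg e x)%:R * (delta * a) by ring.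
by rewrite ler_pM2l // mulrC (le_trans Kle).
Qed.

Lemma vertex_spectral_measure_le (delta : R) x : 0 <= delta < 2 ->
  vertex_spectral_measure e x delta <= ((deg e x)%:R * delta / Kconst R e)%:C.
Proof.
case/andP=> d0 d2; rewrite /vertex_spectral_measure /spectral_proj /orth_proj.
case: xgetP => [f _ [Wf Hf]|_].
  (* Testing the orthogonality of the projection against [f] itself shows that its squared norm is
     its inner product with the unit vector. *)
  have := Hf f Wf; rewrite dotdBl => /eqP; rewrite subr_eq0 => /eqP uf.
  have ff : dotd e f f = (\sum_y (deg e y)%:R * sqmod (f y))%:C by rewrite dotd_norm.
  rewrite dotd_conj uf ff conj_real lecR.
  apply: (spectral_subspace_bound (delta := delta) (f := f)) => //.
    by rewrite sumr_ge0 // => y _; rewrite mulr_ge0 ?ler0n ?sqmod_ge0.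
  by rewrite dotd_conj uf ff conj_real.
(* Default branch of [xget]: the function is zero and the bound is nonnegative. *)
rewrite dotd_unit_vec mulr0 ler0c divr_ge0 ?mulr_ge0 ?ler0n //.
exact/ltW/Kconst_gt0.
Qed.

End VertexMeasure.

(** * Eigenbasis, eigenvalue bounds and mixing *)

Section SpectralTheorem.

Lemma char_poly_similar (F : fieldType) n (P A B : 'M[F]_n) :
  P \in unitmx -> P *m B = A *m P -> char_poly A = char_poly B.
Proof.
rewrite unitmxE unitfE => P0 PBA.
have detP : \det (map_mx polyC P) != 0 by rewrite det_map_mx polyC_eq0.
apply: (mulIf detP); rewrite [RHS]mulrC /char_poly -!det_mulmx; congr (\det _).
rewrite /char_poly_mx mulmxBr mulmxBl -!map_mxM PBA; congr (_ - _).
by rewrite scalar_mxC.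
Qed.

Variables (R : realType) (V : finType) (e : rel V).
Hypotheses (e_sym : symmetric e) (e_irr : irreflexive e).
Hypotheses (e_conn : connected_graph e) (e_nbip : ~ bipartite e).

(* The matrix [A] of P in the basis 1_x / sqrt (d x) is Hermitian. *)
Lemma transition_spectral_theorem :
  exists (phi : 'I_#|V| -> V -> R[i]) (lam : 'I_#|V| -> R),
  [/\ forall i j, dotd e (phi i) (phi j) = (i == j)%:R,
      forall x y, \sum_j phi j x * (phi j y)^* = (x == y)%:R / (deg e x)%:R,
      forall j, transition_eigen e (lam j) (phi j) &
      perm_eq (char_roots (op_mx (@transition_op R V e)))
              [seq (lam j)%:C | j <- enum 'I_#|V|]].
Proof.
pose w x : R[i] := (Num.sqrt (deg e x)%:R)%:C.
have w0 x : w x != 0.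
  have : (Num.sqrt (deg e x)%:R : R) != 0 by rewrite sqrtr_eq0 -ltNge deg_pos.
  by apply: contra => /eqP[->].
have wc x : (w x)^*%R = w x by apply: conj_real.
have ww x : (deg e x)%:R = w x * w x.
  by rewrite -rmorphM -expr2 sqr_sqrtr ?ler0n //= rmorph_nat.
pose A : 'M[R[i]]_#|V| := \matrix_(i, j)
  ((e (enum_val i) (enum_val j))%:R / (w (enum_val i) * w (enum_val j))).
have Aherm : A \is hermsymmx.
  apply/is_hermitianmxP; rewrite expr0 scale1r; apply/matrixP => i j.
  rewrite !mxE conjM conjV conjM !wc conjC_nat e_sym; congr (_ / _).
  exact: mulrC.
have /orthomx_spectralP AE := hermitian_normalmx Aherm.
have Uu := spectral_unitarymx A; have Dr := hermitian_spectral_diag_real Aherm.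
set U := spectralmx A in AE Uu; set D := spectral_diag A in AE Dr.
have Uunit := unitarymx_unit Uu.
have UA : U *m A = diag_mx D *m U by rewrite [in LHS]AE -mulmxA mulKVmx.
pose lam j := complex.Re (D 0 j).
have lamE j : D 0 j = (lam j)%:C by rewrite RRe_real //; apply: (mxOverP Dr).
have sumV (F : V -> R[i]) : \sum_x F x = \sum_(k < #|V|) F (enum_val k).
  by rewrite (reindex _ (onW_bij _ (enum_val_bij V))).
(* Undoing the change of basis on the rows of the unitary matrix [U]: its rows give orthonormality,
   its columns completeness. Its rows are left eigenvectors of [A], and right ones because [A] is
   symmetric. *)
exists (fun j x => U j (enum_rank x) / w x), lam; split.
- move=> i j; have := unitarymxP Uu => /matrixP/(_ i j); rewrite !mxE => <-.
  rewrite /dotd sumV; apply: eq_bigr => k _; rewrite !mxE enum_valK ww conjM conjV wc.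
  by have := w0 (enum_val k); move: (w _) => s s0; field.
- move=> x y; have := mulVmx Uunit; rewrite invmx_unitary //.
  move=> /matrixP/(_ (enum_rank y) (enum_rank x)); rewrite !mxE => UE.
  transitivity ((\sum_j (U j (enum_rank y))^* * U j (enum_rank x)) / (w x * w y)).
    rewrite mulr_suml; apply: eq_bigr => j _; rewrite conjM conjV wc invfM.
    by ring.
  have -> : \sum_j (U j (enum_rank y))^* * U j (enum_rank x) = (x == y)%:R.
    rewrite -(inj_eq (@enum_rank_inj V)) eq_sym -UE.
    by apply: eq_bigr => j _; rewrite !mxE.
  by rewrite ww; have [->|_] := eqVneq x y; rewrite ?mul0r.
- move=> j x; have := UA => /matrixP/(_ j (enum_rank x)); rewrite mul_diag_mx !mxE lamE => UE.
  rewrite mulrA -UE /transition_op ww invfM big_mkcond sumV mulr_suml mulr_sumr.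
  apply: eq_bigr => k _; rewrite enum_valK mxE enum_rankK (e_sym x).
  by case: e; [rewrite invfM mul1r; ring | rewrite !(mul0r, mulr0)].
- rewrite /char_roots; case: closed_field_poly_normal => r /= rE; apply: prod_XsubC_eq.
  move: rE; rewrite (monicP (char_poly_monic _)) scale1r => <-.
  rewrite -(@char_poly_similar _ _ (U *m diag_mx (\row_i w (enum_val i))) (diag_mx D)).
  + rewrite char_poly_trig ?diag_mx_is_trig // big_map big_enum /=.
    by apply: eq_bigr => i _; rewrite mxE eqxx mulr1n lamE.
  + rewrite unitmx_mul Uunit unitmxE det_diag unitfE; apply/prodf_neq0 => i _.
    by rewrite mxE.
  + rewrite mulmxA -UA -!mulmxA; congr (_ *m _); rewrite mul_diag_mx mul_mx_diag.
    apply/matrixP => i k; rewrite !mxE /transition_op ww.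
    have -> : \sum_(y | e (enum_val i) y) (y == enum_val k)%:R = (e (enum_val i) (enum_val k))%:R :> R[i].
      rewrite big_mkcond (bigD1 (enum_val k)) //= eqxx big1 ?addr0 => [|y /negPf ->]; last by case: ifP.
      by case: e.
    have := w0 (enum_val i); have := w0 (enum_val k).
    by move: (w _) (w (enum_val k)) => s t t0 s0; field; rewrite s0 t0.
Qed.

End SpectralTheorem.

(** * Eigenvalue counting and convergence to equilibrium in an orthonormal eigenbasis *)

Section EigenBasis.
Variables (R : realType) (V : finType) (e : rel V).
Hypotheses (e_sym : symmetric e) (e_irr : irreflexive e).
Hypotheses (e_conn : connected_graph e) (e_nbip : ~ bipartite e).
Variables (phi : 'I_#|V| -> V -> R[i]) (lam : 'I_#|V| -> R).
Hypothesis phi_orth : forall i j, dotd e (phi i) (phi j) = (i == j)%:R.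
Hypothesis phi_complete : forall x y,
  \sum_j phi j x * (phi j y)^* = (x == y)%:R / (deg e x)%:R.
Hypothesis phi_eigen : forall j, transition_eigen e (lam j) (phi j).

Lemma dotd_expansion (J : pred 'I_#|V|) (a b : 'I_#|V| -> R[i]) :
  dotd e (fun x => \sum_(j | J j) a j * phi j x) (fun x => \sum_(j | J j) b j * phi j x) =
  \sum_(j | J j) a j * (b j)^*.
Proof.
rewrite dotd_suml; apply: eq_bigr => i Ji.
rewrite dotdZl dotd_sumr (bigD1 i) //= dotdZr phi_orth eqxx mulr1.
by rewrite big1 ?addr0 // => j /andP[_ /negPf ji]; rewrite dotdZr phi_orth eq_sym ji mulr0.
Qed.

Lemma transition_expansion (J : pred 'I_#|V|) (a : 'I_#|V| -> R[i]) :
  transition_op e (fun x => \sum_(j | J j) a j * phi j x) =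
  fun x => \sum_(j | J j) (a j * (lam j)%:C) * phi j x.
Proof.
apply/funext => x; rewrite /transition_op exchange_big mulr_sumr.
apply: eq_bigr => j _; rewrite -mulrA -(phi_eigen j x) /transition_op -mulr_sumr.
by rewrite mulrCA.
Qed.

Lemma cenergy_expansion (s : R) (J : pred 'I_#|V|) (a : 'I_#|V| -> R[i]) :
  s ^+ 2 = 1 ->
  cenergy e s (fun x => \sum_(j | J j) a j * phi j x) =
  \sum_(j | J j) (1 + s * lam j) * sqmod (a j).
Proof.
move=> s1; apply: complexI; rewrite cenergy_dotd // transition_expansion !dotd_expansion.
rewrite mulr_sumr -big_split rmorph_sum; apply: eq_bigr => j _ /=.
by rewrite rmorphM rmorphD rmorphM rmorph1 /= sqmodE; ring.
Qed.

Lemma sqmod_phi_sum j : \sum_x (deg e x)%:R * sqmod (phi j x) = 1.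
Proof. by apply: complexI; rewrite -dotd_norm phi_orth eqxx. Qed.

(** On [phi j] the nonnegative forms of I + P and I - P take the values [1 + lam j] and
    [1 - lam j]. *)
Lemma eigenvalue_norm j : `|lam j| <= 1.
Proof.
have E s : s ^+ 2 = 1 -> 0 <= 1 + s * lam j.
  move=> s1; have := cenergy_expansion (pred1 j) (fun=> 1) s1.
  rewrite big_pred1_eq -[1]/(1%:C) sqmodR expr1n mulr1 => <-; exact: cenergy_ge0.
have := E 1 (expr1n _ _); have := E (-1); rewrite sqrrN expr1n ler_norml => /(_ erefl).
by lra.
Qed.

(** The left side is the vertex spectral measure at [1 + l] in the eigenbasis: [c j] is the
    coefficient on [phi j] of the unit vector at [x], and [f] is its spectral projection. *)
Lemma eigen_vertex_le (l : R) x : -1 <= l < 1 ->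
  (deg e x)%:R * \sum_(j | lam j <= l) sqmod (phi j x) <=
  (deg e x)%:R * (1 + l) / Kconst R e.
Proof.
case/andP=> l0 l1; pose J := [pred j | lam j <= l].
pose w : R := Num.sqrt (deg e x)%:R; pose c j := w%:C * (phi j x)^*.
have w2 : w ^+ 2 = (deg e x)%:R by rewrite sqr_sqrtr ?ler0n.
have cE : \sum_(j | J j) sqmod (c j) = (deg e x)%:R * \sum_(j | J j) sqmod (phi j x).
  by rewrite mulr_sumr; apply: eq_bigr => j _; rewrite sqmodM sqmodR w2 sqmod_conj.
pose f x := \sum_(j | J j) c j * phi j x.
apply: (spectral_subspace_bound e_sym e_irr e_conn e_nbip (f := f)).
- by lra.
- by rewrite mulr_ge0 ?ler0n ?sumr_ge0 // => j _; rewrite sqmod_ge0.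
- exists #|J|, (fun i y => c (enum_val i) * phi (enum_val i) y); split; last first.
    by move=> y; rewrite /f big_enum_val.
  move=> i; have : enum_val i \in J by apply: enum_valP.
  move: (enum_val i) => j; rewrite inE => lj; exists (1 + lam j).
    by have := eigenvalue_norm j; rewrite ler_norml /=; lra.
  move=> y; rewrite /signless_op.
  have -> : transition_op e (fun y => c j * phi j y) y = c j * transition_op e (phi j) y.
    by rewrite /transition_op -mulr_sumr; ring.
  by rewrite (phi_eigen j y) rmorphD rmorph1 /=; ring.
- rewrite dotd_expansion -cE rmorph_sum; apply: eq_bigr => j _.
  by rewrite /= sqmodE.
- rewrite dotd_unit_vec // -/w mulr_sumr -cE rmorph_sum; apply: eq_bigr => j _ /=.
  by rewrite sqmodE /c conjM conj_real conjCK; ring.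
- by lra.
Qed.

(** Summed over the vertices, each unit eigenvector contributes 1 to the left side of
    [eigen_vertex_le]. *)
Lemma eigen_count_le (l : R) : -1 <= l < 1 ->
  #|[pred j | lam j <= l]|%:R * Kconst R e <= (1 + l) * \sum_x (deg e x)%:R.
Proof.
move=> l01; rewrite -ler_pdivlMr; last exact: Kconst_gt0.
have -> : #|[pred j | lam j <= l]|%:R =
    \sum_x (deg e x)%:R * \sum_(j | lam j <= l) sqmod (phi j x) :> R.
  rewrite -sum1_card natr_sum.
  under [RHS]eq_bigr do rewrite mulr_sumr.
  by rewrite exchange_big; apply: eq_bigr => j _; rewrite sqmod_phi_sum.
rewrite mulr_sumr mulr_suml; apply: ler_sum => x _; rewrite (mulrC (1 + l)).
exact: eigen_vertex_le.
Qed.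

Hypothesis phi_roots : perm_eq (char_roots (op_mx (@transition_op R V e)))
  [seq (lam j)%:C | j <- enum 'I_#|V|].

Lemma perm_spectrum : perm_eq (transition_spectrum R e) [seq lam j | j <- enum 'I_#|V|].
Proof.
rewrite /transition_spectrum perm_sort; apply: perm_trans (perm_map _ phi_roots) _.
by rewrite -map_comp perm_refl.
Qed.

Lemma lambdaP_rank k : (1 <= k <= #|V|)%N ->
  (k <= #|[pred j | (lam j <= lambdaP R e k)%R]|)%N.
Proof.
case/andP=> k1 kn; rewrite /lambdaP; set s := transition_spectrum R e; set l := nth _ _ _.
have ss : size s = #|V| by rewrite (perm_size perm_spectrum) size_map size_enum_ord.
have -> : #|[pred j | lam j <= l]| = count (fun z => z <= l) s.
  by rewrite (permP perm_spectrum) count_map cardE size_filter enumT.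
rewrite -(cat_take_drop k s) count_cat (leq_trans _ (leq_addr _ _)) //.
have sk : size (take k s) = k by rewrite size_takel // ss.
rewrite -[leqLHS]sk eq_leq //; apply/esym/eqP; rewrite -all_count.
apply/(all_nthP 0) => i; rewrite sk => ik; rewrite nth_take //=.
apply: sorted_leq_nth; rewrite ?inE ?ss //.
- exact: le_trans.
- exact: sort_sorted le_total _.
- by rewrite (leq_trans ik).
- by rewrite prednK.
- by rewrite -ltnS prednK.
Qed.

Lemma sum_deg_gt0 : 0 < \sum_x (deg e x)%:R :> R.
Proof.
have [x [y xy]] := edge_exists e_nbip.
rewrite (bigD1 x) //= ltr_wpDr ?sumr_ge0 //; exact: deg_pos.
Qed.

Lemma lambdaP_ge k : (1 <= k <= #|V|)%N ->
  -1 + k%:R * Kconst R e / (\sum_x deg e x)%:R <= lambdaP R e k.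
Proof.
move=> kn; have K0 := Kconst_gt0 R e_sym e_irr e_conn e_nbip.
have S0 := sum_deg_gt0; rewrite natr_sum.
have kJ := lambdaP_rank kn; case/andP: kn => k1 kn.
set l := lambdaP R e k in kJ *; rewrite addrC -lerBrDr opprK ler_pdivrMr //.
(* The counting bound needs [l < 1]. For [l >= 1] it is replaced by [Kconst_le_deg] summed over all
   vertices. *)
have [l1|l1] := leP 1 l.
  apply: (@le_trans _ _ (#|V|%:R * Kconst R e)); first by rewrite ler_wpM2r ?ler_nat ?ltW.
  apply: (@le_trans _ _ (\sum_x (deg e x)%:R)).
    rewrite -sum1_card natr_sum mulr_suml ler_sum // => x _.
    by rewrite mul1r Kconst_le_deg.
  by rewrite ler_peMl ?ltW //; lra.
have l0 : -1 <= l.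
  have /card_gt0P[j] : (0 < #|[pred j | (lam j <= l)%R]|)%N by apply: leq_trans kJ.
  by rewrite inE; have := eigenvalue_norm j; rewrite ler_norml; lra.
rewrite (addrC l); apply: le_trans (eigen_count_le _); last by rewrite l0.
by rewrite ler_wpM2r ?ler_nat // ltW.
Qed.

(** The eigenvectors may be complex while transition probabilities are real, so the real part is
    taken term by term. *)
Definition spectral_kernel j x y : R := complex.Re (phi j x * (phi j y)^*).

Lemma spectral_kernel_bound j x y :
  `|spectral_kernel j x y| <= (sqmod (phi j x) + sqmod (phi j y)) / 2.
Proof.
rewrite /spectral_kernel /sqmod; case: (phi j x) (phi j y) => [a b] [c d] /=.
rewrite mulrN opprK; have := sqr_ge0 (a - c); have := sqr_ge0 (b - d).
have := sqr_ge0 (a + c); have := sqr_ge0 (b + d); rewrite ler_norml.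
by lra.
Qed.

Lemma ReD (z w : R[i]) : complex.Re (z + w) = complex.Re z + complex.Re w.
Proof. by case: z w => a b [c d]. Qed.

Lemma Re_sum (I : Type) (r : seq I) (P : pred I) (F : I -> R[i]) :
  complex.Re (\sum_(i <- r | P i) F i) = \sum_(i <- r | P i) complex.Re (F i).
Proof. exact: (big_morph (@complex.Re R) ReD). Qed.

Lemma ReMr (a : R) (z : R[i]) : complex.Re (a%:C * z) = a * complex.Re z.
Proof. by case: z => c d /=; rewrite mul0r subr0. Qed.

Lemma spectral_kernel_complete x y :
  \sum_j spectral_kernel j x y = (x == y)%:R / (deg e x)%:R.
Proof.
rewrite -Re_sum phi_complete -(rmorph_nat (real_complex R)).
by rewrite -(rmorph_nat (real_complex R) (deg e x)) -fmorphV -rmorphM.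
Qed.

Lemma spectral_kernel_step j x y :
  (deg e x)%:R^-1 * \sum_(z | e x z) spectral_kernel j z y = lam j * spectral_kernel j x y.
Proof.
rewrite /spectral_kernel -Re_sum -ReMr fmorphV rmorph_nat -mulr_suml mulrA.
by rewrite -/(transition_op e (phi j) x) phi_eigen -mulrA ReMr.
Qed.

Lemma trans_prob_spectral t x y :
  trans_prob R e t x y = (deg e y)%:R * \sum_j lam j ^+ t * spectral_kernel j x y.
Proof.
elim: t x => [|t IH] x /=.
  under eq_bigr do rewrite expr0 mul1r.
  rewrite spectral_kernel_complete; have [->|_] := eqVneq x y; last by rewrite mul0r mulr0.
  by rewrite mul1r mulfV // gt_eqF ?deg_pos.
transitivity (\sum_j \sum_(z | e x z)
    (deg e y)%:R * lam j ^+ t * ((deg e x)%:R^-1 * spectral_kernel j z y)).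
  rewrite exchange_big; apply: eq_bigr => z _; rewrite IH !mulr_sumr.
  by apply: eq_bigr => j _; ring.
rewrite mulr_sumr; apply: eq_bigr => j _.
by rewrite -!mulr_sumr spectral_kernel_step exprSr; ring.
Qed.

Lemma eigenvector1_const j x y : lam j = 1 -> phi j x = phi j y.
Proof.
move=> l1; apply: (laplacian_kernel e_sym e_conn).
have s1 : (-1 : R) ^+ 2 = 1 by rewrite sqrrN expr1n.
apply: complexI; rewrite cenergy_dotd //.
rewrite (_ : transition_op e (phi j) = fun x => (lam j)%:C * phi j x); last by apply/funext => z; apply: phi_eigen.
by rewrite dotdZl l1 mul1r rmorphN1 mulN1r subrr.
Qed.

(** Completeness is summed over z with weights d(z): eigenvectors for other eigenvalues are
    orthogonal to the constants and drop out, and those for 1 are constant. *)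
Lemma spectral_kernel1 x y :
  \sum_(j | lam j == 1) spectral_kernel j x y = (\sum_z (deg e z)%:R)^-1.
Proof.
have S0 : 0 < \sum_z (deg e z)%:R :> R by apply: sum_deg_gt0.
apply: (mulIf (x := \sum_z (deg e z)%:R)); rewrite ?gt_eqF // mulVf ?gt_eqF //.
transitivity (\sum_z (deg e z)%:R * \sum_j spectral_kernel j x z); last first.
  rewrite (bigD1 x) //= [X in _ + X = _]big1 => [|z /negPf zx]; last first.
    by rewrite spectral_kernel_complete eq_sym zx mul0r mulr0.
  by rewrite spectral_kernel_complete eqxx addr0 mul1r mulfV // gt_eqF ?deg_pos.
under [RHS]eq_bigr do rewrite mulr_sumr.
rewrite exchange_big /= [RHS](bigID (fun j => lam j == 1)) /= [X in _ = _ + X]big1 ?addr0.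
  rewrite mulr_suml; apply: eq_bigr => j /eqP l1; rewrite mulr_sumr.
  by apply: eq_bigr => z _; rewrite /spectral_kernel (eigenvector1_const y z l1) mulrC.
move=> j l1; have := eigen_orthogonal e_sym e_conn e_nbip (transition_eigen1 R e_conn e_nbip) (phi_eigen j).
rewrite eq_sym => /(_ l1) o1.
transitivity (complex.Re (phi j x * dotd e (fun=> 1) (phi j))); last by rewrite o1 mulr0.
rewrite /dotd mulr_sumr Re_sum; apply: eq_bigr => z _.
by rewrite mulr1 /spectral_kernel -ReMr rmorph_nat mulrCA.
Qed.

(** The sum of the [t.+1] powers r^0, ..., r^t is at least [t.+1%:R * r ^+ t]; multiplied by [1 - r]
    it becomes [1 - r ^+ t.+1]. *)
Lemma geometric_max (t : nat) (r : R) : 0 <= r <= 1 -> t.+1%:R * (1 - r) * r ^+ t <= 1.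
Proof.
case/andP=> r0 r1; suff: t.+1%:R * (1 - r) * r ^+ t <= 1 - r ^+ t.+1.
  by move/le_trans; apply; rewrite gerBl exprn_ge0.
elim: t => [|t IH]; first by rewrite expr0 expr1 mulr1 mul1r.
have q0 : 0 <= r ^+ t.+1 by rewrite exprn_ge0.
have q1 : r ^+ t.+1 <= 1 by rewrite exprn_ile1.
have := ler_wpM2l r0 IH; rewrite -[t.+2]addn1 natrD.
have -> : r * (t.+1%:R * (1 - r) * r ^+ t) = t.+1%:R * (1 - r) * r ^+ t.+1 by rewrite exprS; ring.
have -> : r * (1 - r ^+ t.+1) = r - r ^+ (t.+1 + 1) by rewrite addn1 [r ^+ t.+2]exprS; ring.
move=> h; rewrite mulrDl mulrDl mul1r.
apply: (@le_trans _ _ (r - r ^+ (t.+1 + 1) + (1 - r) * r ^+ t.+1)); first by rewrite lerD2r.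
have : (1 - r) * r ^+ t.+1 <= 1 - r by rewrite ler_piMr // subr_ge0.
by rewrite addn1 [r ^+ t.+2]exprS; lra.
Qed.

(* Applied to sum_j |lam_j|^t conj (phi_j x) phi_j, whose value A at x is to be
   bounded, the hypothesis gives A^2 <= B sum_j (1 - |lam_j|) |lam_j|^2t |phi_j x|^2
   <= B A / (t + 1). *)
Lemma spectral_decay (s B : R) (J : pred 'I_#|V|) t x :
    s ^+ 2 = 1 -> 0 <= B -> (forall j, J j -> s * lam j = - `|lam j|) ->
    (forall a : 'I_#|V| -> R[i],
      sqmod (\sum_(j | J j) a j * phi j x) <=
      B * cenergy e s (fun y => \sum_(j | J j) a j * phi j y)) ->
  \sum_(j | J j) `|lam j| ^+ t * sqmod (phi j x) <= B / t.+1%:R.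
Proof.
move=> s1 B0 Jlam HB; set A := \sum_(j | J j) _.
have A0 : 0 <= A.
  by rewrite sumr_ge0 // => j _; rewrite mulr_ge0 ?sqmod_ge0 ?exprn_ge0.
have t0 : 0 < (t.+1%:R : R) by rewrite ltr0n.
have := HB (fun j => (`|lam j| ^+ t)%:C * (phi j x)^*) .
rewrite cenergy_expansion //.
have -> : \sum_(j | J j) (`|lam j| ^+ t)%:C * (phi j x)^* * phi j x = A%:C.
  rewrite rmorph_sum; apply: eq_bigr => j _ /=.
  by rewrite rmorphM /= sqmodE; ring.
rewrite sqmodR => AB; rewrite ler_pdivlMr //.
have [->|An] := eqVneq A 0; first by rewrite mul0r.
have Ap : 0 < A by rewrite lt_def An.
rewrite -(ler_pM2l Ap) mulrA -expr2 (mulrC A B).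
apply: (le_trans (ler_wpM2r (ltW t0) AB)); rewrite -mulrA ler_wpM2l //.
rewrite mulr_suml; apply: ler_sum => j Jj; rewrite Jlam // sqmodM sqmodR sqmod_conj.
have r01 : 0 <= `|lam j| <= 1 by rewrite normr_ge0 eigenvalue_norm.
have := ler_wpM2r (mulr_ge0 (exprn_ge0 t (normr_ge0 (lam j))) (sqmod_ge0 (phi j x)))
   (geometric_max t r01).
rewrite mul1r; apply: le_trans; rewrite le_eqVlt; apply/orP; left; apply/eqP; ring.
Qed.

(** Nonnegative eigenvalues are controlled by I - P with constant [diam e], negative ones by I + P
    with constant [(diam e).+1]. *)
Lemma nontrivial_decay t x :
  \sum_(j | lam j != 1) `|lam j| ^+ t * sqmod (phi j x) <=
  (2 * (diam e)%:R + 1) / t.+1%:R.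
Proof.
rewrite (bigID (fun j => 0 <= lam j)) /=.
have -> : (2 * (diam e)%:R + 1) / t.+1%:R =
    (diam e)%:R / t.+1%:R + (diam e).+1%:R / t.+1%:R :> R.
  by rewrite -mulrDl -natr1; congr (_ / _); ring.
apply: lerD; [apply: (spectral_decay (s := -1)) | apply: (spectral_decay (s := 1))];
  rewrite ?ler0n //.
- by rewrite sqrrN expr1n.
- by move=> j /andP[_ l0]; rewrite mulN1r ger0_norm.
- move=> a; pose f y := \sum_(j | (lam j != 1) && (0 <= lam j)) a j * phi j y.
  apply: (laplacian_cenergy e_sym e_conn e_nbip (f := f)); rewrite dotd_suml big1 // => j /andP[l1 _].
  rewrite dotdZl (eigen_orthogonal e_sym e_conn e_nbip (phi_eigen j) _ l1) ?mulr0 //.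
  exact: transition_eigen1.
- by rewrite expr1n.
- by move=> j /andP[_]; rewrite -ltNge mul1r => l0; rewrite ltr0_norm // opprK.
- move=> a; pose f y := \sum_(j | (lam j != 1) && ~~ (0 <= lam j)) a j * phi j y.
  exact: (signless_cenergy e_sym e_irr e_conn e_nbip f).
Qed.

(** The eigenvalue 1 contributes exactly the stationary probability. The remaining kernels are
    bounded by the mean of their diagonal values at [x] and [y]. *)
Lemma uniform_distance_le t :
  uniform_distance R e t <=
  (\sum_x (deg e x)%:R) * (2 * (diam e)%:R + 1) / t.+1%:R.
Proof.
set S := \sum_x (deg e x)%:R; set C := _ / t.+1%:R.
have S0 : 0 < S by apply: sum_deg_gt0.
have C0 : 0 <= C by rewrite divr_ge0 ?ler0n // mulr_ge0 ?ltW // ltr_wpDr // mulr_gt0 // ltr0n.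
apply: bigmax_le => // x _; apply: bigmax_le => // y _.
have dy := deg_pos R e_conn e_nbip y.
have SE : 2 * #|edges e|%:R = S by rewrite -natrM -(sum_deg e_sym e_irr) natr_sum.
have piE : stationary R e y = (deg e y)%:R / S by rewrite /stationary SE.
have pi0 : 0 < stationary R e y by rewrite piE divr_gt0.
rewrite ler_pdivrMr // trans_prob_spectral (bigID (fun j => lam j == 1)) /=.
have -> : \sum_(j | lam j == 1) lam j ^+ t * spectral_kernel j x y = S^-1.
  by rewrite -(spectral_kernel1 x y); apply: eq_bigr => j /eqP ->; rewrite expr1n mul1r.
rewrite mulrDr -piE addrAC subrr add0r normrM ger0_norm ?ler0n //.
have -> : C * stationary R e y = (deg e y)%:R * ((2 * (diam e)%:R + 1) / t.+1%:R).
  by rewrite piE /C -[S * _ / _]mulrA; move: (_ / t.+1%:R) => q; field; rewrite gt_eqF.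
rewrite ler_pM2l //; apply: le_trans (ler_norm_sum _ _ _) _.
apply: (@le_trans _ _ ((\sum_(j | lam j != 1) `|lam j| ^+ t * sqmod (phi j x) +
   \sum_(j | lam j != 1) `|lam j| ^+ t * sqmod (phi j y)) / 2)).
  rewrite -big_split mulr_suml ler_sum // => j _ /=.
  by rewrite normrM normrX -mulrDr -mulrA ler_wpM2l ?exprn_ge0 ?spectral_kernel_bound.
have := nontrivial_decay t x; have := nontrivial_decay t y.
by move: (_ / t.+1%:R) => q; lra.
Qed.

End EigenBasis.

(** * The diameter of a regular graph *)

Section RegularDiameter.
Local Open Scope nat_scope.
Variables (V : finType) (e : rel V).
Hypotheses (e_sym : symmetric e) (e_irr : irreflexive e).
Hypothesis e_conn : connected_graph e.

(** Removing the last vertex of a geodesic lowers the distance by exactly one. *)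
Lemma dist_level x y i : i <= dist e x y -> exists z, dist e x z = i.
Proof.
move: {2}(dist e x y) (erefl (dist e x y)) => m; elim: m y => [|m IH] y xy.
  by rewrite xy leqn0 => /eqP ->; exists y.
rewrite leq_eqVlt => /orP[/eqP ->|]; first by exists y.
have [p [xp lp sp]] := dist_path (e_conn x y).
case/lastP: p xp lp sp => [|p z]; first by rewrite xy.
rewrite rcons_path last_rcons size_rcons xy => /andP[xp pz] zy [sp]; subst z.
have := dist_le xp; have := dist_edge e_conn x pz; rewrite xy ltnS sp => h1 h2.
have xl : dist e x (last x p) = m by apply/eqP; rewrite eqn_leq h1 h2.
by rewrite ltnS -xl; apply: IH.
Qed.

Lemma card_near (m k : nat) :
  #|[pred i : 'I_m | (i <= k.+1) && (k <= i.+1)]| <= 3.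
Proof.
rewrite cardE -(size_map val); apply: (@uniq_leq_size _ _ [:: k.-1; k; k.+1]).
  by rewrite map_inj_uniq ?enum_uniq //; apply: val_inj.
move=> _ /mapP[a + ->]; rewrite mem_enum inE => /andP[h1 h2]; rewrite !inE.
by move: h1 h2 => /=; move: (nat_of_ord a) => n; lia.
Qed.

(* Along a geodesic of length [diam e], each vertex at distance [i] from its
   origin has its closed neighbourhood at distances [i - 1], [i] and [i + 1], so
   that every vertex is counted at most three times. *)
Lemma regular_diam r : 0 < #|V| -> (forall x, deg e x = r) ->
  (diam e).+1 * r.+1 <= 3 * #|V|.
Proof.
move=> n0 reg.
have [x [y xy]] : exists x y, dist e x y = diam e.
  have [x xE] := bigop.eq_bigmax (fun x => \max_y dist e x y) n0.
  have [y yE] := bigop.eq_bigmax (fun y => dist e x y) n0.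
  by exists x, y; rewrite /diam xE yE.
have lev (i : 'I_(diam e).+1) : exists z, dist e x z == i.
  have [|z <-] := @dist_level x y i; last by exists z.
  by rewrite xy -ltnS.
pose near (z : V) (i : 'I_(diam e).+1) := (i <= (dist e x z).+1) && (dist e x z <= i.+1).
apply: (@leq_trans (\sum_(i < (diam e).+1) \sum_(z | near z i) 1)).
  rewrite -[X in X * _]card_ord -sum_nat_const leq_sum // => i _.
  have [z /eqP xz] := lev i; rewrite sum1_card -(reg z).
  (* The vertex [z] itself accounts for the extra one in [r.+1]. *)
  have zN : z \notin [set w | e z w] by rewrite inE e_irr.
  rewrite /deg -add1n -[1]/(nat_of_bool true) -zN -cardsU1.
  apply/subset_leq_card/fintype.subsetP => w; rewrite !inE => /orP[/eqP ->|zw]; rewrite unfold_in /near.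
    by rewrite xz !leqnSn.
  have := dist_edge e_conn x zw; rewrite e_sym in zw.
  by have := dist_edge e_conn x zw; rewrite xz => -> ->.
rewrite (exchange_big_dep predT) //= mulnC -sum_nat_const leq_sum // => z _.
by rewrite sum1_card card_near.
Qed.

End RegularDiameter.

(** * From the decay estimate to the mixing time *)

Section MixingTime.
Variables (R : realType) (V : finType) (e : rel V).
Hypotheses (e_sym : symmetric e) (e_irr : irreflexive e).
Hypotheses (e_conn : connected_graph e) (e_nbip : ~ bipartite e).

(** At time [t] equal to four times the product, the bound of [uniform_distance_le] is (t/4)/(t+1),
    which is at most 1/4. *)
Lemma uniform_mixing_time_le (B : nat) :
  (4 * ((\sum_x deg e x) * (2 * diam e + 1)) <= B)%N ->
  (uniform_mixing_time e (1 / 4 : R) <= B%:R%:E)%E.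
Proof.
move=> tB; have [phi [lam [orth compl eig _]]] :=
  transition_spectral_theorem R e_sym e_conn e_nbip.
set t := (4 * _)%N in tB.
apply: ge_ereal_inf; exists t%:R%:E; last by rewrite lee_fin ler_nat.
exists t => //=.
have := uniform_distance_le e_sym e_irr e_conn e_nbip orth compl eig t.
move/le_trans; apply; rewrite ler_pdivrMr ?ltr0n //.
rewrite -natr_sum -(natrM _ 2) natr1 -natrM -[t.+1]addn1 natrD /t natrM addn1.
by lra.
Qed.

End MixingTime.

Theorem proposition1p4 (R : realType) (V : finType) (e : rel V)
  (e_sym : symmetric e) (e_irr : irreflexive e)
  (e_conn : connected_graph e) (e_nbip : ~ bipartite e) :
  quotients e (Kconst R e) /\
  (forall (delta : R) (x : V), 0 <= delta < 2 ->
     vertex_spectral_measure e x delta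
       <= ((deg e x)%:R * delta / Kconst R e)%:C) /\
  1 / ((diam e)%:R + 1) <= Kconst R e /\
  (forall k : nat, (1 <= k <= #|V|)%N ->
     lambdaP R e k >= -1 + k%:R * Kconst R e / (\sum_(x : V) deg e x)%:R /\
     -1 + k%:R * Kconst R e / (\sum_(x : V) deg e x)%:R
       >= -1 + k%:R / (((diam e)%:R + 1) * (\sum_(x : V) deg e x)%:R)) /\
  (uniform_mixing_time e (1 / 4 : R) <= (8 * #|V|%:R ^+ 3)%:E)%E /\
  (regular e ->
     (uniform_mixing_time e (1 / 4 : R) <= (24 * #|V|%:R ^+ 2)%:E)%E).
Proof.
have [x [y xy]] := edge_exists e_nbip.
have n0 : (0 < #|V|)%N by apply/card_gt0P; exists x.
split; first exact: Kconst_attained.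
split; first by move=> delta z; apply: vertex_spectral_measure_le.
split; first exact: Kconst_ge.
split.
  move=> k kn; split.
    have [phi [lam [orth _ eig roots]]] :=
      transition_spectral_theorem R e_sym e_conn e_nbip.
    exact: (lambdaP_ge e_sym e_irr e_conn e_nbip orth eig roots).
  rewrite lerD2l invfM mulrA ler_wpM2r ?invr_ge0 ?ler0n //.
  by rewrite ler_wpM2l ?ler0n // -[leLHS]mul1r Kconst_ge.
split.
  rewrite -natrX -natrM; apply: uniform_mixing_time_le => //.
  (* The factors 4, n^2 and 2n multiply to 8n^3. *)
  have S : (\sum_x deg e x <= #|V| * #|V|)%N.
    rewrite -[leqRHS]sum_nat_const; apply: leq_sum => z _; exact: max_card.
  have D : (2 * diam e + 1 <= 2 * #|V|)%N.
    by have := diam_lt_card e_conn n0; lia.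
  have := leq_mul S D; rewrite expnS expnS expn1; lia.
case=> r reg; rewrite -natrX -natrM; apply: uniform_mixing_time_le => //.
have := regular_diam e_sym e_irr e_conn n0 reg.
under eq_bigr do rewrite reg; rewrite sum_nat_const expnS expn1.
move: (diam e) #|V| => D n H.
(* The left side is at most 2(D + 1)(r + 1), and [regular_diam] bounds (D + 1)(r + 1) by 3n; the
   remaining factor 4n gives 24n^2. *)
have : (r * (2 * D + 1) <= 6 * n)%N by nia.
by nia.
Qed.
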